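(* Let $K$ be a field of characteristic zero. If $n\geq 2$ is an even integer, then \[\mathrm{Id}(F_n(\mathfrak{N}_3)) = \langle [x_1,x_2,x_3,x_4],\ s_{n+2}(x_1,\dots,x_{n+2})\rangle^T.\] Moreover, $\mathrm{Id}(F_{n+1}(\mathfrak{N}_3)) = \mathrm{Id}(F_n(\mathfrak{N}_3))$.
   Context: All algebras are associative and unitary over a field $K$ of characteristic zero. $K\langle X\rangle$ is the free unitary associative algebra on $X=\{x_1,x_2,\dots\}$. Commutators are left-normed: $[a,b]=ab-ba$ and $[a_1,\dots,a_{m}]=[[a_1,\dots,a_{m-1}],a_m]$ for $m\ge 3$. $I_p$ is the two-sided ideal of $K\langle X\rangle$ generated by all commutators $[u_1,\dots,u_p]$, $u_i\in K\langle X\rangle$. $\mathfrak{N}_p$ is the variety of algebras satisfying $[x_1,\dots,x_{p+1}]=0$, and $F_n(\mathfrak{N}_p)=K\langle x_1,\dots,x_n\rangle/(I_{p+1}\cap K\langle x_1,\dots,x_n\rangle)$. $\mathrm{Id}(A)\subseteq K\langle X\rangle$ is the set of polynomial identities of an algebra $A$. A T-ideal is an ideal of $K\langle X\rangle$ closed under all $K$-algebra endomorphisms of $K\langle X\rangle$; $\langle S\rangle^T$ is the smallest T-ideal containing $S$. The standard polynomial is $s_m(x_1,\dots,x_m)=\sum_{\sigma\in S_m}(-1)^{\sigma}x_{\sigma(1)}\cdots x_{\sigma(m)}$, where $(-1)^\sigma$ is the sign of $\sigma$. *)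

(* Defs.v *)
From HB Require Import structures.
From mathcomp Require Import all_boot all_fingroup all_algebra.
From mathcomp Require Import monalg.
From mathcomp Require Import boolp classical_sets.

Set Implicit Arguments.
Unset Strict Implicit.
Unset Printing Implicit Defensive.

Import GRing.Theory.
Local Open Scope ring_scope.
Local Open Scope classical_set_scope.
Local Open Scope quotient_scope.

(* The free unitary associative algebra on I: finitely supported K-linear
   combinations of words in I. The alias is needed because the library gives
   {malg K[M]} an algType structure only when the monoid M is commutative.
   K<X> is [freealg K nat], where fvar 0, fvar 1, ... stand for x_1, x_2, ...,
   and K<x_1, ..., x_n> is [freealg K 'I_n]. *)
Definition freealg (K : fieldType) (I : choiceType) : Type :=
  {malg K[{fmonom I}]}.

HB.instance Definition _ (K : fieldType) (I : choiceType) :=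
  GRing.Lalgebra.copy (freealg K I) {malg K[{fmonom I}]}.

Section FreeAlgebra.
Variables (K : fieldType) (I : choiceType).
Implicit Types (c : K) (f g : freealg K I).

Lemma freealgC_comm c f : f * c%:MP = c%:MP * f.
Proof.
change (fgmul f c%:MP = fgmul c%:MP f).
rewrite fgmulgU fgmulUg; apply: eq_bigr => k _.
by rewrite mulrC mulm1 mul1m.
Qed.

Lemma freealg_scaleAr c f g : c *: (f * g) = f * (c *: g).
Proof.
have mulC h : c *: h = c%:MP * h by exact: esym (mul_malgC c h).
by rewrite !mulC !mulrA freealgC_comm.
Qed.

HB.instance Definition _ :=
  GRing.Lalgebra_isAlgebra.Build K (freealg K I) freealg_scaleAr.

Definition fvar (i : I) : freealg K I := << fmu i >>.

End FreeAlgebra.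

Section Evaluation.
Variables (K : fieldType) (I : choiceType) (A : algType K) (a : I -> A).

Definition word_eval (m : {fmonom I}) : A := \prod_(i <- (m : seq I)) a i.

Lemma word_eval_morph : mmorphism word_eval.
Proof.
split=> [m1 m2|]; rewrite /word_eval; first by rewrite fmM big_cat.
by rewrite fm1 big_nil.
Qed.

HB.instance Definition _ :=
  monalg.isMultiplicative.Build {fmonom I} A word_eval word_eval_morph.

(* f(a_1, a_2, ...): substitute a i for the variable i. *)
Definition feval (f : freealg K I) : A := mmap (in_alg A) word_eval f.

Lemma feval_zmod : zmod_morphism feval.
Proof. by move=> f g; rewrite /feval; apply: raddfB. Qed.

HB.instance Definition _ :=
  GRing.isZmodMorphism.Build (freealg K I) A feval feval_zmod.

Lemma feval_monoid : monoid_morphism feval.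
Proof.
have cf : forall (g : {malg K[{fmonom I}]}) m m',
    GRing.comm (in_alg A g@_m) (word_eval m').
  by move=> g m m'; rewrite /GRing.comm /= -scalerAl -scalerAr mul1r mulr1.
have [M1 M2] := commr_mmap_is_multiplicative cf.
by split; [exact: M2 | exact: M1].
Qed.

HB.instance Definition _ :=
  GRing.isMonoidMorphism.Build (freealg K I) A feval feval_monoid.

Lemma feval_scalable : scalable feval.
Proof. by move=> c f; rewrite /feval mmapZ /= -scalerAl mul1r. Qed.

HB.instance Definition _ :=
  GRing.isScalable.Build K (freealg K I) A *:%R feval feval_scalable.

Lemma feval_var i : feval (fvar K i) = a i.
Proof.
rewrite /feval mmapU /= scale1r mul1r /word_eval fmU.
by rewrite big_cons big_nil mulr1.
Qed.

End Evaluation.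

Section Ideals.
Variables (K : fieldType).

Definition is_ideal (A : algType K) (J : set A) : Prop :=
  [/\ J 0, forall u v, J u -> J v -> J (u + v)
    & forall a u b, J u -> J (a * u * b)].

Record properIdeal (A : algType K) := ProperIdeal {
  ideal_set : set A;
  ideal_setP : is_ideal ideal_set;
  ideal_set1 : ~ ideal_set 1
}.

Lemma smallest_is_ideal (A : algType K) (S : set A) :
  is_ideal (smallest (@is_ideal A) S).
Proof.
split=> [M [[]]//|u v Ju Jv M MP|a u b Ju M MP].
  by have [[_ D _] _] := MP; apply: D; [apply: Ju | apply: Jv].
by have [[_ _ MM] _] := MP; apply: MM; apply: Ju.
Qed.

End Ideals.

(* The quotient A / J by a two-sided ideal; the library's {ideal_quot J} is a
   ring only when A is commutative. The condition that J is proper is there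
   because the library's algebras are nontrivial. *)
Section QuotientAlgebra.
Variables (K : fieldType) (A : algType K) (J : properIdeal A).

Definition ideal_pred (u : A) : bool := `[< ideal_set J u >].

Lemma ideal_predM a u b : u \in ideal_pred -> a * u * b \in ideal_pred.
Proof.
have [_ _ JM] := ideal_setP J.
by rewrite !unfold_in => /asboolP Ju; apply/asboolP/JM.
Qed.

Lemma ideal_predMl a u : u \in ideal_pred -> a * u \in ideal_pred.
Proof. by rewrite -[a * u]mulr1; apply: ideal_predM. Qed.

Lemma ideal_predMr b u : u \in ideal_pred -> u * b \in ideal_pred.
Proof. by rewrite -[u]mul1r; move=> Ju; apply: ideal_predM; rewrite mul1r in Ju. Qed.

Lemma ideal_pred_zmod : zmod_closed ideal_pred.
Proof.
have [J0 JD JM] := ideal_setP J.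
split=> [|u v]; rewrite !unfold_in; first exact/asboolP.
move=> /asboolP Ju /asboolP Jv; apply/asboolP/JD => //.
by rewrite -[- v]mulr1 -mulN1r; apply: JM.
Qed.

HB.instance Definition _ :=
  GRing.isZmodClosed.Build A ideal_pred ideal_pred_zmod.

Definition ideal_zmod : zmodClosed A :=
  GRing.ZmodClosed.clone A ideal_pred _.

Definition quotalg : Type := {ideal_quot ideal_zmod}.

HB.instance Definition _ := GRing.Zmodule.copy quotalg {ideal_quot ideal_zmod}.

Definition qpi (u : A) : quotalg := \pi_{ideal_quot ideal_zmod} u.
Definition qrepr (x : quotalg) : A := generic_quotient.repr (x : {ideal_quot ideal_zmod}).

Lemma qreprK : cancel qrepr qpi.
Proof. by move=> x; apply: (@reprK _ {ideal_quot ideal_zmod}). Qed.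

Lemma qpi_eqP u v : (qpi u == qpi v) = (u - v \in ideal_pred).
Proof. by rewrite Quotient.idealrBE. Qed.

Lemma qpi_eq0 u : qpi u = 0 <-> ideal_set J u.
Proof.
have q0 : qpi 0 = 0 by exact: (raddf0 (\pi_{ideal_quot ideal_zmod})).
rewrite -q0; split=> [/eqP|Ju]; last apply/eqP; rewrite qpi_eqP subr0 unfold_in.
  by move/asboolP.
exact/asboolP.
Qed.

Lemma qpi_zmod : zmod_morphism qpi.
Proof. exact: (raddfB (\pi_{ideal_quot ideal_zmod})). Qed.

HB.instance Definition _ := GRing.isZmodMorphism.Build A quotalg qpi qpi_zmod.

Lemma qpi_repr u : qrepr (qpi u) - u \in ideal_pred.
Proof. by rewrite -qpi_eqP qreprK. Qed.

Definition qone : quotalg := qpi 1.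
Definition qmul (x y : quotalg) : quotalg := qpi (qrepr x * qrepr y).
Definition qscale (c : K) (x : quotalg) : quotalg := qpi (c *: qrepr x).

Lemma qpi_mul u v : qpi (u * v) = qmul (qpi u) (qpi v).
Proof.
apply/eqP; rewrite eq_sym qpi_eqP.
set u' := qrepr _; set v' := qrepr _.
have -> : u' * v' - u * v = (u' - u) * v' + u * (v' - v).
  by rewrite mulrBl mulrBr addrA subrK.
apply: (rpredD (S := ideal_zmod)).
  exact/ideal_predMr/qpi_repr.
exact/ideal_predMl/qpi_repr.
Qed.

Lemma qpi_scale c u : qpi (c *: u) = qscale c (qpi u).
Proof.
apply/eqP; rewrite eq_sym qpi_eqP -scalerBr -mulr_algl.
exact/ideal_predMl/qpi_repr.
Qed.

Lemma qmulA : associative qmul.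
Proof.
move=> x y z; rewrite -[x]qreprK -[y]qreprK -[z]qreprK.
by rewrite -!qpi_mul mulrA.
Qed.

Lemma qmul1 : left_id qone qmul.
Proof. by move=> x; rewrite -[x]qreprK -qpi_mul mul1r. Qed.

Lemma qmulr1 : right_id qone qmul.
Proof. by move=> x; rewrite -[x]qreprK -qpi_mul mulr1. Qed.

Lemma qmulDl : left_distributive qmul +%R.
Proof.
move=> x y z; rewrite -[x]qreprK -[y]qreprK -[z]qreprK.
by rewrite -raddfD -!qpi_mul mulrDl raddfD.
Qed.

Lemma qmulDr : right_distributive qmul +%R.
Proof.
move=> x y z; rewrite -[x]qreprK -[y]qreprK -[z]qreprK.
by rewrite -raddfD -!qpi_mul mulrDr raddfD.
Qed.

Lemma qone_neq0 : qone != 0.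
Proof. by apply/eqP => /qpi_eq0; apply: ideal_set1. Qed.

HB.instance Definition _ := GRing.Zmodule_isNzRing.Build quotalg
  qmulA qmul1 qmulr1 qmulDl qmulDr qone_neq0.

Lemma qscaleA a b x : qscale a (qscale b x) = qscale (a * b) x.
Proof. by rewrite -[x]qreprK -!qpi_scale scalerA. Qed.

Lemma qscale1 : left_id 1 qscale.
Proof. by move=> x; rewrite -[x]qreprK -qpi_scale scale1r. Qed.

Lemma qscaleDr : right_distributive qscale +%R.
Proof.
move=> c x y; rewrite -[x]qreprK -[y]qreprK.
by rewrite -raddfD -!qpi_scale scalerDr raddfD.
Qed.

Lemma qscaleDl x : {morph qscale^~ x : a b / a + b}.
Proof. by move=> a b; rewrite -[x]qreprK -!qpi_scale scalerDl raddfD. Qed.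

HB.instance Definition _ := GRing.Zmodule_isLmodule.Build K quotalg
  qscaleA qscale1 qscaleDr qscaleDl.

Lemma qscaleAl c (x y : quotalg) : c *: (x * y) = (c *: x) * y.
Proof.
change (qscale c (qmul x y) = qmul (qscale c x) y).
rewrite -[x]qreprK -[y]qreprK.
by rewrite -qpi_mul -!qpi_scale -qpi_mul scalerAl.
Qed.

HB.instance Definition _ := GRing.Lmodule_isLalgebra.Build K quotalg qscaleAl.

Lemma qscaleAr c (x y : quotalg) : c *: (x * y) = x * (c *: y).
Proof.
change (qscale c (qmul x y) = qmul x (qscale c y)).
rewrite -[x]qreprK -[y]qreprK.
by rewrite -qpi_mul -!qpi_scale -qpi_mul scalerAr.
Qed.

HB.instance Definition _ := GRing.Lalgebra_isAlgebra.Build K quotalg qscaleAr.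

Lemma qpi_monoid : monoid_morphism qpi.
Proof. by split=> // u v; apply: qpi_mul. Qed.

HB.instance Definition _ :=
  GRing.isMonoidMorphism.Build A quotalg qpi qpi_monoid.

Lemma qpi_scalable : scalable qpi.
Proof. exact: qpi_scale. Qed.

HB.instance Definition _ :=
  GRing.isScalable.Build K A quotalg *:%R qpi qpi_scalable.

End QuotientAlgebra.

Section Commutators.
Variable R : nzRingType.

Definition comm (a b : R) : R := a * b - b * a.

(* [u_1, ..., u_m] for s = [:: u_1; ...; u_m]. *)
Definition lncomm (s : seq R) : R :=
  if s is u :: s' then foldl comm u s' else 0.

End Commutators.

Section RelativelyFree.
Variable K : fieldType.

Definition commIdeal (p : nat) : set (freealg K nat) :=
  smallest (@is_ideal K (freealg K nat))
    [set f | exists u : p.-tuple (freealg K nat), f = lncomm u].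

(* The inclusion of K<x_1, ..., x_n> in K<X>. *)
Definition fincl (n : nat) : freealg K 'I_n -> freealg K nat :=
  feval (fun i : 'I_n => fvar K (val i)).

(* The intersection of I_{p+1} with K<x_1, ..., x_n>, as a preimage. *)
Definition relfreeSet (n p : nat) : set (freealg K 'I_n) :=
  @fincl n @^-1` commIdeal p.+1.

Lemma relfreeSet_ideal n p : is_ideal (@relfreeSet n p).
Proof.
have [I0 ID IM] := smallest_is_ideal
  [set f | exists u : p.+1.-tuple (freealg K nat), f = lncomm u].
rewrite /relfreeSet /fincl; split=> [|u v|a u b]; rewrite /preimage /mkset.
- by rewrite raddf0.
- by rewrite raddfD; apply: ID.
- by rewrite !rmorphM; apply: IM.
Qed.

Lemma relfreeSet_proper n p : (0 < p)%N -> ~ @relfreeSet n p 1.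
Proof.
move=> p_gt0; rewrite /relfreeSet /fincl /preimage /mkset rmorph1.
pose h : {rmorphism freealg K nat -> K^o} := feval (fun=> 0 : K^o).
have hI : is_ideal [set f | h f = 0].
  split=> [|f g|a f b]; rewrite /mkset.
  - exact: rmorph0.
  - by rewrite rmorphD => -> ->; rewrite addr0.
  - by rewrite !rmorphM => ->; rewrite mulr0 mul0r.
move/(smallest_sub hI) => H.
suff : h 1 = 0 by rewrite rmorph1; apply/eqP/oner_neq0.
apply: H => f /= [u ->]; case: u => -[|u s] //= su.
have : s != [::] by case: s su p_gt0 => //= /eqP [<-].
case/lastP: s {su} => // s v _; rewrite -cats1 foldl_cat /= /comm.
by rewrite rmorphB !rmorphM /= [X in X - _]mulrC subrr.
Qed.

Definition relfreeIdeal (n p : nat) (p_gt0 : (0 < p)%N) :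
    properIdeal (freealg K 'I_n) :=
  ProperIdeal (@relfreeSet_ideal n p) (@relfreeSet_proper n p p_gt0).

(* F_n(N_p). For p = 0 it would be the zero algebra, whence p_gt0. *)
Definition relfree (n p : nat) (p_gt0 : (0 < p)%N) : algType K :=
  quotalg (relfreeIdeal n p_gt0).

End RelativelyFree.

Section Identities.
Variable K : fieldType.
Local Notation KX := (freealg K nat).

Definition Id (A : algType K) : set KX :=
  [set f | forall a : nat -> A, feval a f = 0].

Definition is_Tideal (J : set KX) : Prop :=
  is_ideal J /\
  forall (phi : {lrmorphism KX -> KX}) f, J f -> J (phi f).

Definition Tideal_gen (S : set KX) : set KX := smallest is_Tideal S.

Definition standard_poly (m : nat) : KX :=
  \sum_(s : 'S_m) (-1) ^+ s * \prod_(i < m) fvar K (val (s i)).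

End Identities.

(* Main.v *)
Require Import Defs.
From mathcomp Require Import all_boot all_fingroup all_algebra.
From mathcomp Require Import monalg.
From mathcomp Require Import boolp classical_sets.

Set Implicit Arguments.
Unset Strict Implicit.
Unset Printing Implicit Defensive.

Import GRing.Theory.
Local Open Scope ring_scope.
Local Open Scope classical_set_scope.

(** Write N3 for the identity [x1,x2,x3,x4] = 0 and T for the T-ideal on the
    right-hand side. The proof compares the inclusions
    Id(F_n) <= T <= Id(F_(n+1)) <= Id(F_n), the last one because F_n embeds in
    F_(n+1).

    In an algebra with N3 every product [a,b,c][d,e] vanishes (comm3_comm2), so
    pair commutators commute with one another, triple commutators are central,
    and a product of at least three pair commutators is alternating in all its
    entries (comm2_comm2_swap). In every even degree m the standard polynomial
    is, up to a nonzero factor, the alternating sum of the products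
    [a1,a2]...[a(m-1),am] of pair commutators (alt_pair_prod).

    T <= Id(F_(n+1)): with at least two factors such a product is a derivation
    in each entry (pair_prodM), so the alternating sum is determined by its
    values on generators; it has n + 2 entries, two of which coincide when there
    are only n + 1 generators (standard_few_generators).

    Id(F_n) <= T: it is enough to show that an identity of F_n holds in every
    algebra B with N3 and s_(n+2), and then to take B = K<X>/T. In characteristic
    zero one may linearize (Id_multilinear_sub), and then, since the algebras are
    unitary, restrict to multilinear polynomials that vanish when any variable is
    set to 1; modulo N3 these are combinations of products of pair commutators
    and of single triple commutators (Id_comm_span_sub). What is left depends on
    the degree m. For m odd and different from 3 nothing is left. For m even and
    different from 4 one product [x1,x2]...[x(m-1),xm] is left: for m <= n it is
    detected by a Grassmann algebra on n generators, and for m >= n + 2 it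
    vanishes in B because of s_(n+2). In degrees 3 and 4 the remaining
    polynomials are detected by two nilpotent matrix algebras on two generators,
    except for a multiple of s_4, which is handled like the even degrees. *)

(** * Identities in noncommutative rings *)

Section NcRing.

(** The tactic [ncring] proves identities that hold in every ring. A polynomial
    is normalized to a list of signed words: coefficients are always 1 or -1, with
    repetition in place of multiplicity, so that a difference vanishes exactly
    when all its words cancel in pairs. *)
Inductive ncexpr :=
  | NcVar of nat | NcZero | NcOne
  | NcAdd of ncexpr & ncexpr | NcOpp of ncexpr | NcMul of ncexpr & ncexpr.

Fixpoint nc_insert (p : bool * seq nat) (l : seq (bool * seq nat)) :=
  if l is q :: l' then
    if (p.2 == q.2) && (p.1 != q.1) then l' else q :: nc_insert p l'
  else [:: p].

Definition nc_mulp (p q : bool * seq nat) := (p.1 (+) q.1, p.2 ++ q.2).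

Fixpoint nc_norm (e : ncexpr) : seq (bool * seq nat) :=
  match e with
  | NcVar i => [:: (false, [:: i])]
  | NcZero => [::]
  | NcOne => [:: (false, [::])]
  | NcAdd e1 e2 => foldr nc_insert (nc_norm e2) (nc_norm e1)
  | NcOpp e1 => [seq (~~ p.1, p.2) | p <- nc_norm e1]
  | NcMul e1 e2 =>
      foldr nc_insert [::] [seq nc_mulp p q | p <- nc_norm e1, q <- nc_norm e2]
  end.

Variables (R : nzRingType) (env : seq R).

Fixpoint nc_eval (e : ncexpr) : R :=
  match e with
  | NcVar i => env`_i
  | NcZero => 0
  | NcOne => 1
  | NcAdd e1 e2 => nc_eval e1 + nc_eval e2
  | NcOpp e1 => - nc_eval e1
  | NcMul e1 e2 => nc_eval e1 * nc_eval e2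
  end.

Definition nc_evalp (p : bool * seq nat) : R :=
  (-1) ^+ p.1 * \prod_(i <- p.2) env`_i.
Definition nc_evall l : R := \sum_(p <- l) nc_evalp p.

Lemma nc_insertP p l : nc_evall (nc_insert p l) = nc_evalp p + nc_evall l.
Proof.
rewrite /nc_evall; elim: l => [|q l IH] /=; first by rewrite big_seq1 big_nil addr0.
case: ifP => [/andP[/eqP w_eq sgn]|_]; rewrite !big_cons ?IH.
  rewrite addrA /nc_evalp w_eq -mulrDl.
  by case: p.1 q.1 sgn => [] [] //=; rewrite ?expr0 ?expr1 ?addNr ?subrr mul0r add0r.
by rewrite addrCA.
Qed.

Lemma nc_foldP l l' :
  nc_evall (foldr nc_insert l' l) = nc_evall l + nc_evall l'.
Proof.
elim: l => [|p l IH] /=; first by rewrite /nc_evall big_nil add0r.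
by rewrite nc_insertP IH /nc_evall big_cons addrA.
Qed.

Lemma nc_normP e : nc_eval e = nc_evall (nc_norm e).
Proof.
elim: e => [i|||e1 IH1 e2 IH2|e1 IH1|e1 IH1 e2 IH2] /=.
- by rewrite /nc_evall big_seq1 /nc_evalp big_seq1 mul1r.
- by rewrite /nc_evall big_nil.
- by rewrite /nc_evall big_seq1 /nc_evalp big_nil mulr1.
- by rewrite nc_foldP IH1 IH2.
- rewrite IH1 /nc_evall big_map -sumrN; apply: eq_bigr => p _.
  by rewrite /nc_evalp /= signrN mulNr.
rewrite nc_foldP {2}/nc_evall big_nil addr0 IH1 IH2 /nc_evall.
rewrite big_distrlr /= big_allpairs_dep /=.
apply: eq_bigr => p _; apply: eq_bigr => q _.
rewrite /nc_evalp /= big_cat /= signr_addb -!mulrA; congr (_ * _).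
by rewrite !mulrA; congr (_ * _); rewrite commr_sign.
Qed.

Lemma nc_correct e1 e2 :
  nilp (nc_norm (NcAdd e1 (NcOpp e2))) -> nc_eval e1 = nc_eval e2.
Proof.
move/nilP => nil; apply/eqP; rewrite -subr_eq0; apply/eqP.
by rewrite -[LHS]/(nc_eval (NcAdd e1 (NcOpp e2))) nc_normP nil /nc_evall big_nil.
Qed.

End NcRing.

Ltac nc_index x l :=
  match l with
  | x :: _ => constr:(0%N)
  | _ :: ?l' => let n := nc_index x l' in constr:(S n)
  end.

Ltac nc_add x l0 l :=
  match l with
  | nil => constr:(x :: l0)
  | x :: _ => l0
  | _ :: ?l' => nc_add x l0 l'
  end.

Ltac nc_atoms l t :=
  match t with
  | 0%R => l
  | 1%R => l
  | (?a + ?b)%R => let l' := nc_atoms l a in nc_atoms l' b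
  | (- ?a)%R => nc_atoms l a
  | (?a * ?b)%R => let l' := nc_atoms l a in nc_atoms l' b
  | _ => nc_add t l l
  end.

Ltac nc_reify l t :=
  match t with
  | 0%R => constr:(NcZero)
  | 1%R => constr:(NcOne)
  | (?a + ?b)%R =>
      let ea := nc_reify l a in let eb := nc_reify l b in constr:(NcAdd ea eb)
  | (- ?a)%R => let ea := nc_reify l a in constr:(NcOpp ea)
  | (?a * ?b)%R =>
      let ea := nc_reify l a in let eb := nc_reify l b in constr:(NcMul ea eb)
  | _ => let n := nc_index t l in constr:(NcVar n)
  end.

Ltac ncring :=
  rewrite /comm ?mulr2n;
  match goal with
  | |- @eq ?T ?a ?b =>
      let l0 := constr:(@nil T) in
      let l1 := nc_atoms l0 a in
      let l := nc_atoms l1 b in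
      let ea := nc_reify l a in
      let eb := nc_reify l b in
      apply: (@nc_correct _ l ea eb); vm_compute; reflexivity
  end.

(** * Lie nilpotent algebras of class 3 *)

Section N3.
Variables (K : fieldType) (charK0 : [pchar K] =i pred0).

Definition lie_nil3 (A : algType K) := forall a b c d : A,
  comm (comm (comm a b) c) d = 0.

Lemma natK_neq0 n : (n.+1)%:R != 0 :> K.
Proof. by rewrite ((pcharf0P K).1 charK0). Qed.

Lemma mulrn_eq0_char0 (V : lmodType K) (v : V) n : v *+ n.+1 = 0 -> v = 0.
Proof.
move/eqP; rewrite -scaler_nat scaler_eq0 (negPf (natK_neq0 n)) /=.
by move/eqP.
Qed.

Variable (A : algType K) (nil3 : lie_nil3 A).
Implicit Types a b c d e f u v : A.
Notation "[[ a , b ]]" := (comm a b) (at level 0).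

Lemma comm_sub0 a b : [[a, b]] = 0 -> a * b = b * a.
Proof. by move=> ab0; apply/eqP; rewrite -subr_eq0 -[_ - _]/[[a, b]] ab0. Qed.

Lemma comm3_central a b c d : d * [[ [[a, b]], c]] = [[ [[a, b]], c]] * d.
Proof. by apply/esym/comm_sub0/nil3. Qed.

Lemma comm2_commute a b c d : [[a, b]] * [[c, d]] = [[c, d]] * [[a, b]].
Proof.
have -> : [[a, b]] * [[c, d]] = [[c, d]] * [[a, b]]
   + [[ [[ [[a, b]], c]], d]] - [[ [[ [[a, b]], d]], c]] by ncring.
by rewrite !nil3 addr0 subr0.
Qed.

(* In its last three arguments T is alternating, and in the first three it
   satisfies the Jacobi identity. Write T(a,b;c,d,e) = sgn * S(ab), where sgn is
   the sign of the ordering abcde; S is then a function on the edges of the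
   complete graph on the five letters whose sum over every triangle is zero. Such
   a function is zero when 2 and 3 are invertible. *)
Let T a b c d e := [[ [[a, b]], c]] * [[d, e]].

Let T_skew34 a b c d e : T a b c d e = - T a b d c e.
Proof.
have : [[ [[ [[a, b]], c * d]], e]] = 0 by apply: nil3.
have -> : [[ [[ [[a, b]], c * d]], e]] =
  T a b c d e + [[c, e]] * [[ [[a, b]], d]] + c * [[ [[ [[a,b]], d]], e]]
  + [[ [[ [[a,b]], c]], e]] * d by rewrite /T; ncring.
rewrite !nil3 mul0r mulr0 !addr0 comm3_central => /eqP.
by rewrite addr_eq0 => /eqP.
Qed.

Let T_skew45 a b c d e : T a b c d e = - T a b c e d.
Proof. by rewrite /T; ncring. Qed.

Let T_skew12 a b c d e : T a b c d e = - T b a c d e.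
Proof. by rewrite /T; ncring. Qed.

Let T_jacobi a b c d e : T a b c d e + T b c a d e + T c a b d e = 0.
Proof. by rewrite /T; ncring. Qed.

(* Twice the sum of S over a star da, db, dc is a signed sum over the four
   triangles on a, b, c, d. *)
Let T_star a b c d e : T a d b c e + T b d c a e + T c d a b e = 0.
Proof.
apply: (@mulrn_eq0_char0 _ _ 1).
have j1 := T_jacobi a b d c e; have j2 := T_jacobi a c d b e.
have j3 := T_jacobi b c d a e; have j4 := T_jacobi a b c d e.
rewrite (T_skew34 a b d) (T_skew34 b d a) (T_skew12 d a b) in j1.
rewrite (T_skew12 d a c) (T_skew34 a d c) in j2.
rewrite (T_skew34 b c d) (T_skew34 c d b) (T_skew12 d b c) in j3.
rewrite (T_skew12 c a b) (T_skew34 a c b) in j4.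
transitivity (- 0 + 0 - 0 - 0 : A); last by rewrite oppr0 !addr0.
rewrite -{1}j1 -{1}j2 -{1}j3 -{1}j4; ncring.
Qed.

(* Two stars that share two edges: S(dc) = S(de). *)
Let T_skew15 a b c d e : T a b c d e = - T e b c d a.
Proof.
have s1 := T_star c d a b e; have s2 := T_star c d e b a.
rewrite (T_skew45 c b d e a) (T_skew34 d b e) (T_skew45 d b c e) 
        (T_skew34 d b c a) opprK in s2.
apply/eqP; rewrite -addr_eq0; apply/eqP.
transitivity (0 + 0 : A); last by rewrite addr0.
by rewrite -{1}s1 -{1}s2; ncring.
Qed.

(** All edges at a vertex carry the same value of S, so a star gives 3 S = 0. *)
Lemma comm3_comm2 a b c d e : [[ [[a, b]], c]] * [[d, e]] = 0.
Proof.
rewrite -/(T a b c d e); apply: (@mulrn_eq0_char0 _ _ 2).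
have s := T_star a d c b e.
have e1 : T d b c a e = T a b d c e.
  by rewrite T_skew45 T_skew15 T_skew45 T_skew34 !opprK.
have e2 : T c b a d e = T a b d c e.
  rewrite T_skew34 T_skew45 T_skew15 T_skew34 T_skew45 T_skew34 !opprK.
  by rewrite T_skew34 T_skew45 T_skew34 !opprK.
rewrite e1 e2 in s.
by rewrite T_skew34 -[RHS]oppr0 -s mulrS; ncring.
Qed.

Lemma comm2_comm3 a b c d e : [[d, e]] * [[ [[a, b]], c]] = 0.
Proof. by rewrite comm3_central comm3_comm2. Qed.

(** Expanding [a, bc, d] exhibits [a,b][c,d] + [a,c][b,d] as a combination of
    triple commutators, which a further commutator annihilates. *)
Lemma comm2_comm2_swap a b c d e f :
  [[a, b]] * [[c, d]] * [[e, f]] = - ([[a, c]] * [[b, d]] * [[e, f]]).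
Proof.
have : [[ [[a, b * c]], d]] * [[e, f]] = 0 by apply: comm3_comm2.
have -> : [[ [[a, b * c]], d]] * [[e, f]] =
  b * ([[ [[a, c]], d]] * [[e, f]]) + [[b, d]] * [[a, c]] * [[e, f]] 
  + [[a, b]] * [[c, d]] * [[e, f]] + [[ [[a, b]], d]] * c * [[e, f]] by ncring.
rewrite -[_ * c]comm3_central -[c * _ * _]mulrA !comm3_comm2 !mulr0 add0r addr0.
by rewrite (comm2_commute b) => /eqP; rewrite addrC addr_eq0 => /eqP.
Qed.

End N3.

(** * Products of pair commutators *)

Section PairProducts.

Fixpoint pair_prod {R : nzRingType} (s : seq R) {struct s} : R :=
  if s is a :: b :: s' then comm a b * pair_prod s' else 1.

Lemma even_cons2 (T : Type) (s : seq T) (P : seq T -> Prop) :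
  P [::] -> (forall a b s', ~~ odd (size s') -> P s' -> P (a :: b :: s')) ->
  ~~ odd (size s) -> P s.
Proof.
move=> P0 P2; have [n] := ubnP (size s).
elim: n s => // n IH [|a [|b s]] //= /ltnW lt_s; rewrite negbK => s_even.
by apply: P2 => //; apply: IH.
Qed.

Lemma pair_prod_cat (R : nzRingType) (u v : seq R) :
  ~~ odd (size u) -> pair_prod (u ++ v) = pair_prod u * pair_prod v.
Proof.
by elim/even_cons2: u / => /= [|a b u _ ->]; rewrite ?mul1r ?mulrA.
Qed.

Lemma pair_prod_swap_even (R : nzRingType) (u v : seq R) a b :
  ~~ odd (size u) ->
  pair_prod (u ++ a :: b :: v) = - pair_prod (u ++ b :: a :: v).
Proof. by move=> u_even; rewrite !pair_prod_cat //=; ncring. Qed.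

Lemma rmorph_pair_prod (R S : nzRingType) (h : {rmorphism R -> S}) s :
  h (pair_prod s) = pair_prod (map h s).
Proof.
have [n] := ubnP (size s); elim: n s => // n IH [|a [|b s]] //= /ltnW lt_s.
- exact: rmorph1.
- exact: rmorph1.
by rewrite rmorphM IH // rmorphB !rmorphM.
Qed.

Variables (K : fieldType) (charK0 : [pchar K] =i pred0).
Variables (A : algType K) (nil3 : lie_nil3 A).
Implicit Types (a b c d x y : A) (u v : seq A).

Lemma comm_pair_prod a b u : comm a b * pair_prod u = pair_prod u * comm a b.
Proof.
have [n] := ubnP (size u); elim: n u => // n IH [|c [|d u]] //= /ltnW lt_u.
- by rewrite mulr1 mul1r.
- by rewrite mulr1 mul1r.
by rewrite mulrA (comm2_commute nil3) -!mulrA IH.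
Qed.

Lemma pair_prod_swap_odd u v a b c d :
  ~~ odd (size u) -> ~~ odd (size v) -> (0 < size u + size v)%N ->
  pair_prod (u ++ c :: a :: b :: d :: v) =
    - pair_prod (u ++ c :: b :: a :: d :: v).
Proof.
move=> u_even v_even uv; rewrite !pair_prod_cat //=.
case: v v_even uv => [|e [|f v]] //= _; last first.
  move=> _; rewrite !mulrA -!(mulrA (pair_prod u)).
  by rewrite (comm2_comm2_swap charK0 nil3) mulNr mulrN.
case: u u_even => [|e' [|f' u]] //= _ _; rewrite !mulr1.
rewrite comm_pair_prod -!mulrA -mulrN; congr (_ * _).
rewrite !mulrA !(comm2_commute nil3 e' f') -!mulrA !(comm2_commute nil3 e' f') !mulrA.
exact: comm2_comm2_swap.
Qed.

(** Length 4 is a true exception: [a,b][c,d] + [a,c][b,d] need not vanish when there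
    is no third commutator to annihilate it. In length 2 no odd position occurs. *)
Lemma pair_prod_swap m u v a b :
  ~~ odd m -> m != 4%N -> size (u ++ a :: b :: v) = m ->
  pair_prod (u ++ a :: b :: v) = - pair_prod (u ++ b :: a :: v).
Proof.
move=> m_even m4 size_m; have [u_odd|] := boolP (odd (size u)); last first.
  exact: pair_prod_swap_even.
case/lastP: u => // u c in u_odd size_m *.
rewrite size_rcons /= in u_odd.
case: v => [|d v] in size_m *.
  by move: m_even; rewrite -size_m size_cat size_rcons oddD /= u_odd.
rewrite -cats1 -!catA /=; apply: pair_prod_swap_odd => //.
  by move: m_even; rewrite -size_m size_cat size_rcons oddD /= (negPf u_odd) /= !negbK.
move: m4; rewrite -size_m size_cat size_rcons [(size (_ :: _))]/= addSn !addnS !eqSS.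
by rewrite lt0n.
Qed.

Lemma pair_prod_mulC u x a b :
  pair_prod u * x * comm a b = x * pair_prod u * comm a b.
Proof.
have [n] := ubnP (size u); elim: n u => // n IH [|c [|d u]] //= /ltnW lt_u.
- by rewrite mulr1 mul1r.
- by rewrite mulr1 mul1r.
rewrite -!mulrA (mulrA (pair_prod u)) IH // -!comm_pair_prod.
have -> : comm c d * (x * pair_prod u * comm a b) =
   x * (comm c d * (pair_prod u * comm a b)) + 
   comm (comm c d) x * (pair_prod u * comm a b) by ncring.
rewrite -comm_pair_prod (mulrA (comm (comm _ _) _)).
by rewrite (comm3_comm2 charK0 nil3) mul0r addr0.
Qed.

Lemma pair_prod_comm3 u v a b c : (1 < size u + size v)%N ->
  ~~ odd (size u) -> 
  pair_prod u * (comm (comm a b) c * pair_prod v) = 0.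
Proof.
move=> uv u_even; case: v uv => [|d [|e v]]; last first.
- by rewrite /= (mulrA (comm (comm _ _) _)) (comm3_comm2 charK0 nil3) mul0r mulr0.
- case: u u_even => [|d' [|e' u]] //= _ _.
  rewrite comm_pair_prod -mulrA (mulrA _ _ 1) (comm2_comm3 charK0 nil3).
  by rewrite mul0r mulr0.
case: u u_even => [|d [|e u]] //= _ _.
rewrite comm_pair_prod -mulrA (mulrA _ _ 1) (comm2_comm3 charK0 nil3).
by rewrite mul0r mulr0.
Qed.

(** The defect of the Leibniz rule is a triple commutator, which is annihilated as
    soon as there is a second factor. *)
Lemma pair_prodM u v x y : ~~ odd (size (u ++ x :: v)) ->
  (2 < size (u ++ x :: v))%N ->
  pair_prod (u ++ (x * y) :: v) =
    x * pair_prod (u ++ y :: v) + y * pair_prod (u ++ x :: v).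
Proof.
have distr (P Q Q' Q'' S : A) :
    P * ((Q + Q' + Q'') * S) = P * (Q * S) + P * (Q' * S) + P * (Q'' * S).
  by rewrite !mulrDl !mulrDr.
rewrite !size_cat /= addnS !ltnS => m_even m_gt.
have [u_odd|u_even] := boolP (odd (size u)).
  case/lastP: u => // u c in u_odd m_even m_gt *.
  rewrite size_rcons /= in u_odd m_even m_gt.
  rewrite -cats1 -!catA /= !pair_prod_cat //=.
  have -> : comm c (x * y) = x * comm c y + y * comm c x + comm (comm c x) y by ncring.
  rewrite distr pair_prod_comm3 ?addr0 //; last first.
    by move: m_even m_gt; rewrite addSn negbK; case: (size u + size v)%N => [|[|k]].
  by rewrite !mulrA !pair_prod_mulC.
rewrite !pair_prod_cat //.
case: v => [|c v] /= in m_even m_gt *; first by rewrite addn0 u_even in m_even.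
have -> : comm (x * y) c = x * comm y c + y * comm x c + comm (comm x c) y by ncring.
rewrite distr pair_prod_comm3 ?addr0 //; last first.
  by move: m_even m_gt; rewrite addnS /= negbK; case: (size u + size v)%N => [|[|k]].
by rewrite !mulrA !pair_prod_mulC.
Qed.

Lemma comm_linearl k x y a : comm (k *: x + y) a = k *: comm x a + comm y a.
Proof.
by rewrite /comm mulrDl mulrDr -scalerAl -scalerAr opprD addrACA scalerBr.
Qed.

Lemma comm_linearr k x y a : comm a (k *: x + y) = k *: comm a x + comm a y.
Proof.
by rewrite /comm mulrDl mulrDr -scalerAl -scalerAr opprD addrACA scalerBr.
Qed.

Lemma pair_prod_linear u v k x y :
  ~~ odd (size (u ++ x :: v)) -> pair_prod (u ++ (k *: x + y) :: v) =
    k *: pair_prod (u ++ x :: v) + pair_prod (u ++ y :: v).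
Proof.
have distr (P Q Q' S : A) :
    P * ((k *: Q + Q') * S) = k *: (P * (Q * S)) + P * (Q' * S).
  by rewrite mulrDl mulrDr -scalerAl -scalerAr.
rewrite size_cat /= addnS /= negbK => m_odd.
have [u_odd|u_even] := boolP (odd (size u)).
  case/lastP: u => // u c in u_odd m_odd *; rewrite size_rcons /= in u_odd.
  by rewrite -cats1 -!catA /= !pair_prod_cat //= comm_linearr distr.
rewrite !pair_prod_cat //.
case: v => [|c v] /= in m_odd *; first by rewrite addn0 (negPf u_even) in m_odd.
by rewrite comm_linearl distr.
Qed.

Lemma pair_prod_one u v :
  ~~ odd (size (u ++ (1 : A) :: v)) -> pair_prod (u ++ 1 :: v) = 0.
Proof.
rewrite size_cat /= addnS /= negbK => m_odd.
have [u_odd|u_even] := boolP (odd (size u)).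
  case/lastP: u => // u c in u_odd m_odd *; rewrite size_rcons /= in u_odd.
  by rewrite -cats1 -!catA /= !pair_prod_cat //= /comm mulr1 mul1r subrr mul0r mulr0.
rewrite !pair_prod_cat //.
case: v => [|c v] /= in m_odd *; first by rewrite addn0 (negPf u_even) in m_odd.
by rewrite /comm mulr1 mul1r subrr mul0r mulr0.
Qed.

End PairProducts.

(** * Alternating sums and the standard polynomial *)

Section Alternation.
Variables (R : nzRingType) (m : nat).
Implicit Types (F : ('I_m -> R) -> R) (x : 'I_m -> R) (s t : 'S_m).

Definition alt F x : R := \sum_(s : 'S_m) (-1) ^+ s * F (x \o s).

Lemma comp_permM x s t : x \o t \o s = x \o (s * t)%g.
Proof. by apply: funext => i /=; rewrite permM. Qed.

Lemma alt_perm F x t : alt F (x \o t) = (-1) ^+ t * alt F x.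
Proof.
rewrite /alt (reindex_inj (mulIg t^-1%g)) big_distrr /=; apply: eq_bigr => s _.
by rewrite comp_permM mulgKV odd_permM odd_permV addbC signr_addb mulrA.
Qed.

Lemma alt_comp F x t : alt (fun y => F (y \o t)) x = (-1) ^+ t * alt F x.
Proof.
rewrite [in RHS]/alt (reindex_inj (mulgI t)) big_distrr /=; apply: eq_bigr => s _.
rewrite comp_permM mulrA -signr_addb odd_permM addbA addbb.
by rewrite addFb.
Qed.

Lemma eq_alt F G x : (forall y, F y = G y) -> alt F x = alt G x.
Proof. by move=> FG; apply: eq_bigr => s _; rewrite FG. Qed.

Lemma altB F G x : alt (fun y => F y - G y) x = alt F x - alt G x.
Proof. by rewrite /alt -sumrB; apply: eq_bigr => s _; rewrite mulrBr. Qed.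

Lemma altD F G x : alt (fun y => F y + G y) x = alt F x + alt G x.
Proof. by rewrite /alt -big_split; apply: eq_bigr => s _; rewrite mulrDr. Qed.

Lemma altMr F c x : alt (fun y => F y * c) x = alt F x * c.
Proof. by rewrite /alt big_distrl; apply: eq_bigr => s _; rewrite mulrA. Qed.

Lemma alt_alternating F x :
  (forall s, F (x \o s) = (-1) ^+ s * F x) -> alt F x = F x *+ m`!.
Proof.
move=> Falt; rewrite /alt (eq_bigr (fun=> F x)) => [|s _].
  by rewrite sumr_const card_Sn.
by rewrite Falt mulrA -signr_addb addbb mul1r.
Qed.

(** A transposition (i j) is the conjugate of (i k) by the adjacent transposition
    (k j), k = j - 1; every permutation is a product of transpositions. *)
Lemma alternating_adjacent F :
  (forall x (i j : 'I_m), j = i.+1 :> nat -> F (x \o tperm i j) = - F x) ->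
  forall x s, F (x \o s) = (-1) ^+ s * F x.
Proof.
move=> Fadj.
have PM s t : (forall x, F (x \o s) = (-1) ^+ s * F x) ->
    (forall x, F (x \o t) = (-1) ^+ t * F x) ->
    forall x, F (x \o (s * t)%g) = (-1) ^+ (s * t)%g * F x.
  move=> Ps Pt x; rewrite -comp_permM Ps Pt mulrA -signr_addb.
  by rewrite odd_permM.
have Pt d : forall i j : 'I_m, (j = i + d.+1 :> nat)%N -> 
    forall x, F (x \o tperm i j) = (-1) ^+ tperm i j * F x.
  elim: d => [|d IH] i j j_eq x.
    have ij : i != j by rewrite -val_eqE /= j_eq addn1 neq_ltn leqnn.
    by rewrite odd_tperm ij expr1 mulN1r; apply: Fadj; rewrite j_eq addn1.
  have lt_k : (i + d.+1 < m)%N.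
    by apply: leq_ltn_trans (ltn_ord j); rewrite j_eq leq_add2l.
  pose k := Ordinal lt_k.
  have -> : tperm i j = ((tperm k j)^-1 * (tperm i k * tperm k j))%g.
    rewrite -[RHS]/((tperm i k ^ tperm k j)%g) tpermJ tpermL tpermD //.
      by rewrite -val_eqE /= neq_ltn -addSnnS leq_addr orbT.
    by rewrite -val_eqE /= j_eq neq_ltn -addSnnS leq_addr orbT.
  have Pkj y : F (y \o tperm k j) = (-1) ^+ tperm k j * F y.
    have kj : k != j by rewrite -val_eqE /= j_eq eqn_add2l neq_ltn leqnn.
    by rewrite odd_tperm kj expr1 mulN1r; apply: Fadj; rewrite j_eq addnS.
  rewrite tpermV; apply: (PM) => // y; apply: (PM) => // z.
  exact: IH.
move=> x s; have [ts -> _] := prod_tpermP s.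
elim: ts x => [|[i j] ts IH] x.
  rewrite big_nil odd_perm1 mul1r; congr F.
  by apply: funext => i /=; rewrite perm1.
rewrite big_cons; apply: (PM) => // y /=.
have [ij|ji|/val_inj ->] := ltngtP i j.
- by apply: (Pt (j - i).-1); rewrite prednK ?subn_gt0 // subnKC // ltnW.
- by rewrite tpermC; apply: (Pt (i - j).-1); rewrite prednK ?subn_gt0 // subnKC // ltnW.
rewrite tperm1 odd_perm1 mul1r; congr F.
by apply: funext => k /=; rewrite perm1.
Qed.

End Alternation.

Lemma codom_split (T : Type) (m : nat) (x : 'I_m -> T) (i : 'I_m) :
  codom x = take i (codom x) ++ x i :: drop i.+1 (codom x).
Proof.
have sz : size (codom x) = m by rewrite size_codom card_ord.
rewrite -{1}(cat_take_drop i (codom x)) (drop_nth (x i)) ?sz //.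
by rewrite codomE (nth_map i) ?size_enum_ord ?nth_ord_enum.
Qed.

Lemma codom_tperm (T : Type) (m : nat) (x : 'I_m -> T) (i j : 'I_m) :
  j = i.+1 :> nat ->
  exists u v, [/\ size u = i, codom x = u ++ x i :: x j :: v &
                  codom (x \o tperm i j) = u ++ x j :: x i :: v].
Proof.
move=> j_eq; pose e := enum 'I_m.
have e_eq : e = take i e ++ i :: j :: drop i.+2 e.
  have sz : size e = m by rewrite size_enum_ord.
  rewrite -{1}(cat_take_drop i e) (drop_nth i) ?sz // (drop_nth i) ?sz -?j_eq //.
  by rewrite !nth_ord_enum.
have e_uniq : uniq e by apply: enum_uniq.
exists (map x (take i e)), (map x (drop i.+2 e)); split.
- by rewrite size_map size_takel // size_enum_ord ltnW.
- by rewrite codomE -/e {1}e_eq map_cat.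
rewrite codomE -/e {1}e_eq map_cat /= tpermL tpermR.
rewrite e_eq cat_uniq /= !inE !negb_or in e_uniq.
case/and3P: e_uniq => _ /and3P[i_u j_u _] /and3P[/andP[_ i_v] j_v _].
congr (_ ++ [:: _, _ & _]); apply/eq_in_map => k k_in /=; rewrite tpermD //.
- by apply: contraNneq i_u => k_eq; move: k_in; rewrite -k_eq.
- by apply: contraNneq j_u => k_eq; move: k_in; rewrite -k_eq.
- by apply: contraNneq i_v => k_eq; move: k_in; rewrite -k_eq.
- by apply: contraNneq j_v => k_eq; move: k_in; rewrite -k_eq.
Qed.

Section StandardPolynomial.
Variables (R : nzRingType) (m : nat).
Implicit Types x : 'I_m -> R.

(* Interpolates between the plain product (j = 0) and the product of pair
   commutators (j = m / 2). *)
Let half_paired (j : nat) x : R :=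
  pair_prod (take j.*2 (codom x)) * \prod_(a <- drop j.*2 (codom x)) a.

(** Each new commutator doubles the alternating sum: it is the difference of a
    monomial and of its image under a transposition, whose sign is -1. *)
Lemma alt_pair_prod x : ~~ odd m ->
  alt (pair_prod \o codom) x = alt (fun y => \prod_i y i) x *+ 2 ^ m./2.
Proof.
move=> m_even.
have sz y : size (codom (y : 'I_m -> R)) = m by rewrite size_codom card_ord.
have step j : (j < m./2)%N -> alt (half_paired j.+1) x = alt (half_paired j) x *+ 2.
  move=> lt_j; have lt_jm : (j.*2.+1 < m)%N.
    by rewrite -doubleS -(even_halfK m_even) leq_double.
  pose i0 := Ordinal (ltnW lt_jm); pose i1 := Ordinal lt_jm.
  rewrite (eq_alt (G := fun y => half_paired j y - half_paired j (y \o tperm i0 i1))).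
    have i01 : i0 != i1 by rewrite -val_eqE /= neq_ltn leqnn.
    by rewrite altB alt_comp odd_tperm i01 expr1 mulN1r opprK mulr2n.
  move=> y; rewrite /= /half_paired.
  have [u [v [su -> ->]]] := @codom_tperm _ _ y i0 i1 erefl.
  rewrite doubleS -[j.*2]su.
  have cut (a b : R) : let l := u ++ a :: b :: v in
      (take (size u).+2 l = u ++ [:: a; b]) * (drop (size u).+2 l = v).
    have -> /= : u ++ a :: b :: v = (u ++ [:: a; b]) ++ v by rewrite -catA.
    have -> : (size u).+2 = size (u ++ [:: a; b]) by rewrite size_cat addn2.
    by rewrite take_size_cat // drop_size_cat.
  rewrite !cut !take_size_cat // !drop_size_cat // !big_cons pair_prod_cat /=.
    by ncring.
  by rewrite su /= odd_double.
have half_step j : (j <= m./2)%N ->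
    alt (half_paired j) x = alt (half_paired 0) x *+ 2 ^ j.
  elim: j => [|j IH] lt_j; first by rewrite expn0.
  by rewrite step // IH ?(ltnW lt_j) // -mulrnA expnSr.
rewrite -(@eq_alt _ _ (half_paired m./2)); last first.
  by move=> y; rewrite /half_paired even_halfK // take_oversize ?drop_oversize
    ?sz // big_nil mulr1.
rewrite half_step //; congr (_ *+ _); apply: eq_alt => y.
rewrite /half_paired drop0 take0 mul1r codomE big_map.
by rewrite enumT [index_enum _]unlock.
Qed.

End StandardPolynomial.

(** * The standard identity *)

Section StandardIdentity.
Variables (K : fieldType) (charK0 : [pchar K] =i pred0).
Variables (A : algType K) (nil3 : lie_nil3 A).

Definition sats_standard (R : nzRingType) (m : nat) :=
  forall x : 'I_m -> R, alt (fun y => \prod_i y i) x = 0.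

Lemma mulrn_exp2_eq0 (V : lmodType K) (v : V) k : v *+ 2 ^ k = 0 -> v = 0.
Proof.
elim: k => [|k IH]; first by rewrite expn0.
by rewrite expnSr mulrnA => /(mulrn_eq0_char0 charK0).
Qed.

Lemma pair_prod_cat_alternating m (r : seq A) (x : 'I_m -> A) (s : 'S_m) :
  ~~ odd (m + size r) -> (m + size r)%N != 4%N ->
  pair_prod (codom (x \o s) ++ r) = (-1) ^+ s * pair_prod (codom x ++ r).
Proof.
move=> even_m m4.
pose F y := pair_prod (codom (y : 'I_m -> A) ++ r); rewrite -/(F x) -/(F _).
apply: alternating_adjacent => {}x i j j_eq; rewrite /F.
have [u [v [_ eqx eqxt]]] := codom_tperm x j_eq.
rewrite eqx eqxt -!catA /= (pair_prod_swap charK0 nil3 even_m) //.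
have <- : size (codom (x \o tperm i j)) = m by rewrite size_codom card_ord.
by rewrite -size_cat eqxt -catA.
Qed.

(** The product, as a function of its first m entries, is alternating; hence m!
    times it is its own alternating sum, which is a multiple of the standard
    polynomial. *)
Lemma pair_prod_eq0_standard m (l : seq A) :
  ~~ odd m -> sats_standard A m -> ~~ odd (size l) -> size l != 4%N ->
  (m <= size l)%N -> pair_prod l = 0.
Proof.
move=> m_even std l_even l4 le_ml.
pose x (i : 'I_m) := l`_i; pose r := drop m l.
have codom_x : codom x = take m l.
  apply: (@eq_from_nth _ 0); first by rewrite size_codom card_ord size_takel.
  move=> i; rewrite size_codom card_ord => lt_i.
  rewrite codomE (nth_map (Ordinal lt_i)) ?size_enum_ord // nth_take //.
  by rewrite /x nth_enum_ord.
have size_r : (m + size r)%N = size l by rewrite size_drop subnKC.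
have alt0 : alt (fun y => pair_prod (codom y ++ r)) x = 0.
  rewrite (@eq_alt _ _ _ (fun y => (pair_prod \o codom) y * pair_prod r)).
    by rewrite altMr alt_pair_prod // std mul0rn mul0r.
  by move=> y; rewrite pair_prod_cat // size_codom card_ord.
have := alt0; rewrite alt_alternating => [|s]; last first.
  by apply: pair_prod_cat_alternating; rewrite size_r.
rewrite codom_x cat_take_drop -(prednK (fact_gt0 m)).
exact: mulrn_eq0_char0.
Qed.

Let mid_swap (l : seq A) :=
  if l is [:: a; b; c; d] then [:: a; c; b; d] else l.
Let end_cycle (l : seq A) :=
  if l is [:: a; b; c; d] then [:: a; d; b; c] else l.

(** In degree 4 a single product of pair commutators is not alternating, but this
    sum of three is, and its three terms have the same alternating sum. *)
Lemma pair_prod4_standard a b c d : sats_standard A 4 ->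
  comm a b * comm c d - comm a c * comm b d + comm a d * comm b c = 0 :> A.
Proof.
move=> std.
pose p1 (y : 'I_4 -> A) := pair_prod (codom y).
pose p2 (y : 'I_4 -> A) := pair_prod (mid_swap (codom y)).
pose p3 (y : 'I_4 -> A) := pair_prod (end_cycle (codom y)).
pose h y := p1 y - p2 y + p3 y.
pose o (i : nat) (lt_i : (i < 4)%N) := Ordinal lt_i.
have alt_p1 y : alt p1 y = 0.
  by rewrite -[LHS]/(alt (pair_prod \o codom) y) alt_pair_prod // std mul0rn.
have alt_p2 y : alt p2 y = 0.
  have -> : alt p2 y = alt (fun z => p1 (z \o tperm (@o 1%N isT) (@o 2%N isT))) y.
    apply: eq_alt => z; rewrite /p1 /p2.
    have [u [v [su cz cz']]] := @codom_tperm _ _ z (@o 1%N isT) (@o 2%N isT) erefl.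
    have := size_codom z; rewrite card_ord cz cz' size_cat /= su.
    by case: u v su {cz cz'} => [|u0 [|u1 u]] [|v0 [|v1 v]].
  by rewrite alt_comp alt_p1 mulr0.
have alt_p3 y : alt p3 y = 0.
  have -> : alt p3 y = alt (fun z => p2 (z \o tperm (@o 2%N isT) (@o 3%N isT))) y.
    apply: eq_alt => z; rewrite /p2 /p3.
    have [u [v [su cz cz']]] := @codom_tperm _ _ z (@o 2%N isT) (@o 3%N isT) erefl.
    have := size_codom z; rewrite card_ord cz cz' size_cat /= su.
    by case: u v su {cz cz'} => [|u0 [|u1 [|u2 u]]] [|v0 v].
  by rewrite alt_comp alt_p2 mulr0.
have h_alt : forall x (s : 'S_4), h (x \o s) = (-1) ^+ s * h x.
  apply: alternating_adjacent => x i j j_eq; rewrite /h /p1 /p2 /p3.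
  have [u [v [su cx cx']]] := codom_tperm x j_eq.
  have := size_codom x; rewrite card_ord cx cx' size_cat /=.
  case: u {su cx cx'} => [|u0 [|u1 [|u2 u]]]; case: v => [|v0 [|v1 [|v2 v]]];
    rewrite /= ?addSn ?add0n ?addn2 ?addnS //= => _; rewrite !mulr1.
  - rewrite (comm2_commute nil3 (x j) v0) (comm2_commute nil3 (x j) v1); ncring.
  - ncring.
  ncring.
have alt_h y : alt h y = 0.
  rewrite (@altD _ _ (fun y => p1 y - p2 y)) altB.
  by rewrite alt_p1 alt_p2 alt_p3 subrr addr0.
pose x (i : 'I_4) := [:: a; b; c; d]`_i.
have codom_x : codom x = [:: a; b; c; d].
  apply: (@eq_from_nth _ 0); first by rewrite size_codom card_ord.
  move=> i; rewrite size_codom card_ord => lt_i.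
  by rewrite codomE (nth_map (Ordinal lt_i)) ?size_enum_ord // /x nth_enum_ord.
have := alt_h x; rewrite alt_alternating // /h /p1 /p2 /p3 codom_x /= !mulr1.
exact: (@mulrn_eq0_char0 _ _ _ _ 23).
Qed.

Definition ffun_upd (m : nat) (x : 'I_m -> A) (i : 'I_m) (u : A) : 'I_m -> A :=
  fun j => if j == i then u else x j.

Lemma codom_upd m (x : 'I_m -> A) i u :
  codom (ffun_upd x i u) = take i (codom x) ++ u :: drop i.+1 (codom x).
Proof.
rewrite (codom_split _ i) {2}/ffun_upd eqxx.
have := enum_uniq 'I_m; set e := enum 'I_m => e_uniq.
have codom_e (z : 'I_m -> A) : codom z = map z e by rewrite codomE.
have sz : size e = m by rewrite size_enum_ord.
have e_eq : e = take i e ++ i :: drop i.+1 e.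
  by rewrite -{1}(cat_take_drop i e) (drop_nth i) ?sz // nth_ord_enum.
rewrite e_eq cat_uniq /= negb_or in e_uniq.
case/and3P: e_uniq => _ /andP[i_u _] /andP[i_v _].
clearbody e; rewrite !codom_e -!map_take -!map_drop.
have off (e' : seq 'I_m) : i \notin e' -> map (ffun_upd x i u) e' = map x e'.
  move=> i_e'; apply/eq_in_map => k k_in; rewrite /ffun_upd.
  by case: eqP => // k_eq; case/negP: i_e'; rewrite -k_eq.
by rewrite !off.
Qed.

Lemma ffun_upd_perm m (x : 'I_m -> A) i u (s : 'S_m) :
  ffun_upd x i u \o s = ffun_upd (x \o s) (s^-1%g i) u.
Proof.
apply: funext => j; rewrite /ffun_upd /=.
by rewrite -(inj_eq (@perm_inj _ s) j) permKV.
Qed.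

Variables (m : nat) (m_even : ~~ odd m).
Let G := alt (pair_prod \o @codom 'I_m A).

Lemma alt_upd_linear x i k u v :
  G (ffun_upd x i (k *: u + v)) = k *: G (ffun_upd x i u) + G (ffun_upd x i v).
Proof.
rewrite /G /alt scaler_sumr -big_split; apply: eq_bigr => s _ /=.
rewrite !ffun_upd_perm !codom_upd pair_prod_linear ?mulrDr ?scalerAr //.
by rewrite -codom_upd size_codom card_ord.
Qed.

Lemma alt_upd1 x i : G (ffun_upd x i 1) = 0.
Proof.
rewrite /G /alt big1 // => s _ /=.
rewrite ffun_upd_perm codom_upd pair_prod_one ?mulr0 //.
by rewrite -codom_upd size_codom card_ord.
Qed.

Lemma alt_updM x i u v : (2 < m)%N ->
  G (ffun_upd x i (u * v)) = u * G (ffun_upd x i v) + v * G (ffun_upd x i u).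
Proof.
move=> m_gt2.
rewrite /G /alt !big_distrr -big_split; apply: eq_bigr => s _ /=.
rewrite !ffun_upd_perm !codom_upd pair_prodM -?codom_upd ?size_codom ?card_ord //.
by rewrite mulrDr !mulrA !(commr_sign _ s).
Qed.

(** The alternating sum of products of pair commutators is a derivation in each
    entry, so one entry after another may be assumed to be a generator; by the
    pigeonhole principle two of them are then equal. *)
Lemma standard_few_generators k (y : 'I_k -> A) : (2 < m)%N -> (k < m)%N ->
  (forall P : A -> Prop, P 1 -> (forall i, P (y i)) ->
    (forall c u v, P u -> P v -> P (c *: u + v)) ->
    (forall u v, P u -> P v -> P (u * v)) -> forall u, P u) ->
  sats_standard A m.
Proof.
move=> m_gt2 lt_km gen x; apply: (@mulrn_exp2_eq0 _ _ m./2).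
rewrite -alt_pair_prod // -/G.
have letters j z : (forall i : 'I_m, (j <= i)%N -> exists l, z i = y l) -> G z = 0.
  elim: j z => [|j IH] z z_let.
    have [f fP] : exists f : 'I_m -> 'I_k, forall i, z i = y (f i).
      by exists (fun i => sval (cid (z_let i isT))) => i; case: cid.
    have /injectivePn[i [j ij fij]] : ~~ injectiveb f.
      apply/negP => /injectiveP /leq_card; rewrite !card_ord.
      by rewrite leqNgt lt_km.
    have : G (z \o tperm i j) = - G z by rewrite /G alt_perm odd_tperm ij expr1 mulN1r.
    have -> : z \o tperm i j = z.
      apply: funext => l /=; case: tpermP => // ->; rewrite !fP ?fij //.
    move/eqP; rewrite -addr_eq0 -mulr2n => /eqP.
    exact: mulrn_eq0_char0.
  have [lt_j|le_j] := ltnP j m; last first.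
    by apply: IH => i le_ji; have := leq_trans le_j le_ji; rewrite leqNgt ltn_ord.
  pose i0 := Ordinal lt_j.
  have -> : z = ffun_upd z i0 (z i0).
    by apply: funext => i; rewrite /ffun_upd; case: eqP => // ->.
  apply: (gen (fun u => G (ffun_upd z i0 u) = 0)) => [|l|c u v Gu Gv|u v Gu Gv].
  - exact: alt_upd1.
  - apply: IH => i le_ji; rewrite /ffun_upd; case: eqP => [_|i_neq]; first by exists l.
    apply: z_let; rewrite ltn_neqAle le_ji andbT.
    by apply: contra_notN i_neq => /eqP j_eq; apply: val_inj.
  - by rewrite alt_upd_linear Gu Gv scaler0 addr0.
  by rewrite alt_updM // Gu Gv !mulr0 addr0.
by apply: (letters m) => i; rewrite leqNgt ltn_ord.
Qed.

End StandardIdentity.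

(** * The free algebra *)

Section FreeAlgebraTheory.
Variables (K : fieldType) (I : choiceType).
Implicit Types (f g : freealg K I) (w : {fmonom I}).

Definition word (s : seq I) : freealg K I := << FMonom s >>.

Lemma wordE s : word s = \prod_(i <- s) fvar K i.
Proof.
elim: s => [|i s IH]; first rewrite big_nil.
  by rewrite /word -fmoneE; apply: mpolyC1E.
rewrite big_cons -IH /fvar /word fmuE.
rewrite -[RHS]/(fgmul << FMonom [:: i] >> << FMonom s >>) fgmulUU mulr1.
by congr << _ >>; apply/val_inj; rewrite /= fmM.
Qed.

Lemma freealg_sum_words f :
  f = \sum_(w <- finmap.enum_fset (msupp f)) f@_w *: word w.
Proof.
rewrite {1}[f]monalgE; apply: eq_bigr => w _; rewrite /word fmK.
apply/malgP => w'; rewrite mcoeffZ !mcoeffU.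
by rewrite mulrnAr mulr1.
Qed.

Lemma freealg_word_ind (P : freealg K I -> Prop) :
  P 0 -> (forall c s f, P f -> P (c *: word s + f)) -> forall f, P f.
Proof.
move=> P0 Padd f; rewrite [f]freealg_sum_words.
elim: (finmap.enum_fset (msupp f)) => [|w r IH]; first by rewrite big_nil.
by rewrite big_cons; apply: Padd.
Qed.

Lemma freealg_ind (P : freealg K I -> Prop) :
  P 1 -> (forall i, P (fvar K i)) ->
  (forall c f g, P f -> P g -> P (c *: f + g)) ->
  (forall f g, P f -> P g -> P (f * g)) -> forall f, P f.
Proof.
move=> P1 Pvar Plin Pmul.
have P0 : P 0 by rewrite -(subrr 1) addrC -scaleN1r; apply: Plin.
apply: freealg_word_ind => // c s f Pf; apply: Plin => //; rewrite wordE.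
by elim: s => [|i s IHs]; rewrite ?big_nil ?big_cons //; apply: Pmul.
Qed.

Lemma feval_word (A : algType K) (a : I -> A) s :
  feval a (word s) = \prod_(i <- s) a i.
Proof. by rewrite wordE rmorph_prod; apply: eq_bigr => i _; apply: feval_var. Qed.

Lemma eq_feval (A : algType K) (a b : I -> A) f : a =1 b -> feval a f = feval b f.
Proof. by move=> /funext ->. Qed.

Lemma lrmorph_feval (A B : algType K) (h : {lrmorphism A -> B}) (a : I -> A) f :
  h (feval a f) = feval (h \o a) f.
Proof.
elim/freealg_ind: f => [|i|c f g|f g].
- by rewrite !rmorph1.
- by rewrite !feval_var.
- by move=> IHf IHg; rewrite !linearP /= IHf IHg.
by move=> IHf IHg; rewrite !rmorphM /= IHf IHg.
Qed.

Lemma lrmorph_eq_feval (A : algType K) (h : {lrmorphism freealg K I -> A}) f :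
  h f = feval (fun i => h (fvar K i)) f.
Proof.
elim/freealg_ind: f => [|i|c f g|f g].
- by rewrite !rmorph1.
- by rewrite !feval_var.
- by move=> IHf IHg; rewrite !linearP /= IHf IHg.
by move=> IHf IHg; rewrite !rmorphM /= IHf IHg.
Qed.

End FreeAlgebraTheory.

(** * T-ideals, identities and relatively free algebras *)

Lemma rmorph_comm (R S : nzRingType) (h : {rmorphism R -> S}) a b :
  h (comm a b) = comm (h a) (h b).
Proof. by rewrite /comm rmorphB !rmorphM. Qed.

Section IdentityIdeals.
Variable K : fieldType.
Local Notation KX := (freealg K nat).

Lemma Id_Tideal (A : algType K) : is_Tideal (Id A).
Proof.
split; first split=> [a|u v Iu Iv a|u f v If a].
- exact: rmorph0.
- by rewrite rmorphD /= Iu Iv addr0.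
- by rewrite !rmorphM /= If mulr0 mul0r.
move=> phi f If a; pose h : {lrmorphism KX -> A} := feval a.
by rewrite (lrmorph_eq_feval phi) -[LHS]/(h _) lrmorph_feval; apply: If.
Qed.

Lemma feval_comm4 (A : algType K) (a : nat -> A) i j k l :
  feval a (lncomm [:: fvar K i; fvar K j; fvar K k; fvar K l]) =
    comm (comm (comm (a i) (a j)) (a k)) (a l).
Proof.
pose h : {rmorphism KX -> A} := feval a.
have hv t : h (fvar K t) = a t by apply: feval_var.
by rewrite -[LHS]/(h _) /lncomm /foldl !rmorph_comm !hv.
Qed.

Lemma Id_comm4P (A : algType K) :
  Id A (lncomm [:: fvar K 0%N; fvar K 1%N; fvar K 2%N; fvar K 3%N]) <-> lie_nil3 A.
Proof.
split=> [IdA a b c d|nil3 a]; last by rewrite feval_comm4.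
by rewrite -[RHS](IdA (nth 0 [:: a; b; c; d])) feval_comm4.
Qed.

Lemma feval_standard (A : algType K) (a : nat -> A) m :
  feval a (standard_poly K m) = alt (fun y => \prod_i y i) (fun i : 'I_m => a i).
Proof.
rewrite /standard_poly rmorph_sum /=; apply: eq_bigr => s _.
rewrite rmorphM rmorph_sign rmorph_prod; congr (_ * _).
by apply: eq_bigr => i _; apply: feval_var.
Qed.

Lemma Id_standardP (A : algType K) m :
  Id A (standard_poly K m) <-> sats_standard A m.
Proof.
split=> [IdA x|std a]; last by rewrite feval_standard.
have := IdA (nth 0 (codom x)); rewrite feval_standard.
congr (alt _ _ = _); apply: funext => i.
by rewrite codomE (nth_map i) ?size_enum_ord // nth_ord_enum.
Qed.

Section RelativelyFree.
Variable n : nat.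
Local Notation F := (@relfree K n 3 isT).
Local Notation pi := (@qpi K (freealg K 'I_n) (@relfreeIdeal K n 3 isT)).

Lemma relfree_nil3 : lie_nil3 F.
Proof.
move=> a b c d; rewrite -[a]qreprK -[b]qreprK -[c]qreprK -[d]qreprK.
move: (qrepr a) (qrepr b) (qrepr c) (qrepr d) => {}a {}b {}c {}d.
rewrite -!rmorph_comm; apply/qpi_eq0.
rewrite /= /relfreeSet /preimage /mkset.
rewrite /fincl !rmorph_comm -/(fincl _) => M [_ MS].
apply: MS; exists [tuple fincl a; fincl b; fincl c; fincl d].
by rewrite /= /comm.
Qed.

Lemma relfree_generated (P : F -> Prop) : P 1 -> (forall i, P (pi (fvar K i))) ->
  (forall c u v, P u -> P v -> P (c *: u + v)) ->
  (forall u v, P u -> P v -> P (u * v)) -> forall u, P u.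
Proof.
move=> P1 Pvar Plin Pmul u; rewrite -[u]qreprK; move: (qrepr u) => {u}.
elim/freealg_ind => [|//|c f g|f g].
- by rewrite rmorph1.
- by rewrite linearP; apply: Plin.
by rewrite rmorphM; apply: Pmul.
Qed.

Lemma Id_relfree (f : KX) (u : nat -> freealg K 'I_n) :
  Id F f -> commIdeal 4 (fincl (feval u f)).
Proof.
move=> /(_ (pi \o u)); rewrite -lrmorph_feval.
by move/qpi_eq0.
Qed.

(** Identities of F_n can be tested in any algebra A at elements chosen among n
    of its elements. Only the subalgebra generated by the y's has to satisfy N3:
    this allows A to be a full matrix algebra. *)
Lemma Id_relfree_model (A : algType K) (y : nat -> A) (r : nat -> 'I_n) (f : KX) :
  (forall u v w t : KX, 
    comm (comm (comm (feval y u) (feval y v)) (feval y w)) (feval y t) = 0) ->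
  Id F f -> feval (fun i => y (r i)) f = 0.
Proof.
move=> nil3y If; have := Id_relfree (fun i => fvar K (r i)) If.
have ker_ideal : is_ideal [set g : KX | feval y g = 0].
  split=> [|g h|a g b] /=; first exact: rmorph0.
    by move=> yg yh; rewrite rmorphD /= yg yh addr0.
  by move=> yg; rewrite !rmorphM /= yg mulr0 mul0r.
move/(smallest_sub ker_ideal) => /= ker.
rewrite /fincl in ker.
pose h : {lrmorphism KX -> A} := feval y.
pose hi : {lrmorphism freealg K 'I_n -> KX} := feval (fun i : 'I_n => fvar K (val i)).
transitivity (h (hi (feval (fun i => fvar K (r i)) f))); last first.
  apply: ker => g [u ->].
  case: u => -[|u1 [|u2 [|u3 [|u4 [|u5 u]]]]] //= _.
  by rewrite -[RHS](nil3y u1 u2 u3 u4) !rmorph_comm.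
rewrite (lrmorph_feval hi) (lrmorph_feval h); apply: eq_feval => i /=.
have hv j : h (fvar K j) = y j by apply: feval_var.
have hiv (j : 'I_n) : hi (fvar K j) = fvar K (val j) by apply: feval_var.
by rewrite -[RHS]/(h (hi (fvar K (r i)))) hiv hv.
Qed.

End RelativelyFree.

Lemma Id_relfree_widen n : Id (@relfree K n.+1 3 isT) `<=` Id (@relfree K n 3 isT).
Proof.
move=> f If a.
pose iota : {lrmorphism freealg K 'I_n -> freealg K 'I_n.+1} :=
  feval (fun i => fvar K (widen_ord (leqnSn n) i)).
have inc (i : freealg K 'I_n) : fincl (iota i) = fincl i.
  pose hi : {lrmorphism freealg K 'I_n.+1 -> KX} :=
    feval (fun i : 'I_n.+1 => fvar K (val i)).
  rewrite -[LHS]/(hi _) lrmorph_feval; apply: eq_feval => j /=.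
  by rewrite /hi /= feval_var.
have := Id_relfree (fun i => iota (qrepr (a i))) If.
rewrite -(lrmorph_feval iota) inc => ker.
have -> : a = qpi _ \o (fun i => qrepr (a i)) by apply: funext => i /=; rewrite qreprK.
by rewrite -lrmorph_feval; apply/qpi_eq0.
Qed.

End IdentityIdeals.

(** * Test algebras *)

Section Models.
Variables (K : fieldType) (charK0 : [pchar K] =i pred0).
Local Notation KX := (freealg K nat).

Lemma anticommuting_words (A : algType K) (e : nat -> A) (s t : seq nat) :
  (forall i j, e i * e j = - (e j * e i)) ->
  (\prod_(i <- s) e i) * (\prod_(i <- t) e i) =
    (-1) ^+ (size s * size t) * ((\prod_(i <- t) e i) * (\prod_(i <- s) e i)).
Proof.
move=> anti.
have letter i : e i * \prod_(j <- t) e j =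
    (-1) ^+ size t * (\prod_(j <- t) e j * e i).
  elim: t => [|j t IH] /=; first by rewrite big_nil mulr1 !mul1r.
  rewrite !big_cons mulrA anti mulNr -[X in - X]mulrA IH exprS mulN1r mulNr.
  by rewrite !mulrA (commr_sign (e j)).
elim: s => [|i s IH]; first by rewrite big_nil mulr1 !mul1r.
rewrite big_cons -mulrA IH /= mulSn exprD !mulrA (commr_sign (e i)).
by rewrite -(mulrA _ (e i)) letter -!mulrA !mulrA -!exprD addnC.
Qed.

(** Two words commute up to a sign, and a commutator of two words is zero unless
    both lengths are odd; it is then a multiple of a word of even length, which is
    central. *)
Lemma anticommuting_nil2 (A : algType K) (e : nat -> A) :
  (forall i j, e i * e j = - (e j * e i)) ->
  forall u v w : KX, comm (comm (feval e u) (feval e v)) (feval e w) = 0.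
Proof.
move=> anti; pose W s := \prod_(i <- s) e i.
have comm0l (x : A) : comm 0 x = 0 by rewrite /comm mul0r mulr0 subrr.
have comm0r (x : A) : comm x 0 = 0 by rewrite /comm mul0r mulr0 subrr.
have words s t r : comm (comm (W s) (W t)) (W r) = 0.
  rewrite {2}/comm /W (anticommuting_words s t anti) -/(W s) -/(W t) -/(W r).
  have [st_odd|st_even] := boolP (odd (size s * size t)); last first.
    by rewrite -signr_odd (negPf st_even) mul1r subrr comm0l.
  rewrite -signr_odd st_odd expr1 mulN1r.
  have WrC x : x * W r = W r * x -> comm (- x - x) (W r) = 0.
    by move=> xr; rewrite /comm mulrDl mulrDr !mulNr !mulrN xr subrr.
  apply: WrC; rewrite /W -big_cat (anticommuting_words _ r anti) big_cat /=.
  rewrite -signr_odd oddM size_cat oddD.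
  by move: st_odd; rewrite oddM => /andP[-> ->]; rewrite mul1r.
have words2 s t w : comm (comm (W s) (W t)) (feval e w) = 0.
  elim/freealg_word_ind: w => [|c r w IHw]; first by rewrite rmorph0 comm0r.
  by rewrite linearP /= feval_word comm_linearr IHw words scaler0 addr0.
have words1 s v w : comm (comm (W s) (feval e v)) (feval e w) = 0.
  elim/freealg_word_ind: v => [|c t v IHv]; first by rewrite rmorph0 comm0r comm0l.
  rewrite linearP /= feval_word comm_linearr comm_linearl IHv words2.
  by rewrite scaler0 addr0.
move=> u v w; elim/freealg_word_ind: u => [|c s u IHu].
  by rewrite rmorph0 !comm0l.
by rewrite linearP /= feval_word !comm_linearl IHu words1 scaler0 addr0.
Qed.

(** The Grassmann algebra on n generators in matrix form, by doubling the size: the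
    old generators act as diag(e, -e), and the new one as the nilpotent
    block matrix (0, 1; 0, 0). *)
Lemma grassmann_matrices n : exists (d : nat) (e : nat -> 'M[K]_d.+1),
  (forall i j, e i * e j = - (e j * e i)) /\ \prod_(i < n) e i != 0.
Proof.
elim: n => [|n [d [e [anti e_neq0]]]].
  exists 0%N, (fun=> 0); split=> [i j|]; first by rewrite mulr0 oppr0.
  by rewrite big_ord0 oner_neq0.
pose e' i : 'M[K]_(d.+1 + d.+1) :=
  if (i < n)%N then block_mx (e i) 0 0 (- e i)
  else if i == n then block_mx 0 1%:M 0 0 else 0.
exists (d + d.+1)%N, e'; pose N := (d + d.+1)%N.
have blockM (a b c a' b' c' : 'M[K]_d.+1) :
    (block_mx a b 0 c : 'M[K]_N.+1) * block_mx a' b' 0 c' =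
      block_mx (a * a') (a * b' + b * c') 0 (c * c').
  by have := mulmx_block a b 0 c a' b' 0 c'; rewrite !mulmx0 !mul0mx addr0 !add0r.
have blockN (a b c : 'M[K]_d.+1) :
    - (block_mx a b 0 c : 'M[K]_N.+1) = block_mx (- a) (- b) 0 (- c).
  by have := opp_block_mx a b 0 c; rewrite oppr0.
split=> [i j|].
  rewrite /e'; case: (ltnP i n) => i_n; case: (ltnP j n) => j_n.
  - by rewrite !blockM blockN !mulr0 !mul0r addr0 oppr0 mulrNN (anti i j) mulrNN.
  - case: eqP => _; last by rewrite mulr0 mul0r oppr0.
    rewrite !blockM blockN !mulr0 !mul0r !addr0 !oppr0 add0r.
    by rewrite mulr1 mul1r opprK.
  - case: eqP => _; last by rewrite mulr0 mul0r oppr0.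
    rewrite !blockM blockN !mulr0 !mul0r !addr0 !oppr0 add0r.
    by rewrite mulr1 mul1r.
  by case: eqP; case: eqP; rewrite ?mulr0 ?mul0r ?oppr0 // !blockM blockN
    !mulr0 !mul0r !addr0 !oppr0.
have prodE k : (k <= n)%N ->
    exists c, \prod_(i < k) e' i = block_mx (\prod_(i < k) e i) 0 0 c.
  elim: k => [|k IH] lt_k.
    by exists 1%:M; rewrite !big_ord0 -scalar_mx_block.
  have [c eq_c] := IH (ltnW lt_k); exists (c * - e k).
  by rewrite !big_ord_recr /= eq_c /e' lt_k blockM mulr0 mul0r addr0.
rewrite big_ord_recr /=; have [c ->] := prodE n (leqnn n).
rewrite /e' ltnn eqxx blockM !mulr0 !addr0 mulr1.
apply: contraNneq e_neq0 => /(congr1 (@ursubmx _ d.+1 d.+1 d.+1 d.+1)).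
by rewrite block_mxKur => ->; apply/eqP/matrixP => a b; rewrite !mxE.
Qed.

Lemma pair_prod_anticommuting (A : algType K) (e : nat -> A) s : ~~ odd (size s) ->
  (forall i j, e i * e j = - (e j * e i)) ->
  pair_prod (map e s) = (\prod_(i <- s) e i) *+ 2 ^ (size s)./2.
Proof.
move=> s_even anti; elim/even_cons2: s / s_even => [|i j s _ IH] /=.
  by rewrite big_nil.
rewrite IH !big_cons /comm (anti j i) opprK -mulr2n mulrnAl mulrnAr -mulrnA.
by rewrite mulrA expnSr.
Qed.

Section Weights.
Variables (d : nat) (w : 'I_d.+1 -> nat).
Local Notation M := 'M[K]_d.+1.

(** The filtration of the matrix algebra defined by weights on the basis vectors:
    with bounded weights it turns commutator identities into a count of degrees. *)
Definition raises (k : nat) (a : M) := forall i j, (w j < w i + k)%N -> a i j = 0.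

Lemma raises0 k : raises k 0.
Proof. by move=> i j _; rewrite mxE. Qed.

Lemma raises_linear k c a b : raises k a -> raises k b -> raises k (c *: a + b).
Proof. by move=> ra rb i j lt_ij; rewrite !mxE ra ?rb // mulr0 addr0. Qed.

Lemma raisesZ k c a : raises k a -> raises k (c *: a).
Proof.
by move=> ra; rewrite -[c *: a]addr0; apply: raises_linear (@raises0 k).
Qed.

Lemma raisesD k a b : raises k a -> raises k b -> raises k (a + b).
Proof. by move=> ra rb; rewrite -[a]scale1r; apply: raises_linear. Qed.

Lemma raisesB k a b : raises k a -> raises k b -> raises k (a - b).
Proof. by move=> ra rb; rewrite addrC -scaleN1r; apply: raises_linear. Qed.

Lemma raisesM k l a b : raises k a -> raises l b -> raises (k + l) (a * b).
Proof.
move=> ra rb i j lt_ij; rewrite mxE big1 // => p _.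
have [lt_ip|le_ip] := ltnP (w p) (w i + k); first by rewrite ra ?mul0r.
by rewrite rb ?mulr0 // (leq_trans lt_ij) // addnA leq_add2r.
Qed.

Lemma raises_comm k l a b : raises k a -> raises l b -> raises (k + l) (comm a b).
Proof. by move=> ra rb; apply: raisesB; last rewrite addnC; apply: raisesM. Qed.

Lemma raisesW k l a : (k <= l)%N -> raises l a -> raises k a.
Proof.
by move=> le_kl ra i j lt_ij; rewrite ra // (leq_trans lt_ij) // leq_add2l.
Qed.

Lemma raises_eq0 k a : (forall i, w i < k)%N -> raises k a -> a = 0.
Proof.
move=> w_lt ra; apply/matrixP => i j; rewrite ra ?mxE //.
by rewrite (leq_trans (w_lt j)) // leq_addl.
Qed.

(** Modulo terms of degree at least 2, an element of the algebra generated by x and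
    y is a scalar plus a combination of x and y. *)
Lemma raises_split (x y : M) (f : nat -> M) :
  raises 1 x -> raises 1 y -> (forall i, exists a b, f i = a *: x + b *: y) ->
  forall u : KX, exists c a b, raises 2 (feval f u - (c%:A + (a *: x + b *: y))).
Proof.
move=> rx ry fE; elim/freealg_ind => [|i|c u v [cu [au [bu ru]]] [cv [av [bv rv]]]
                              |u v [cu [au [bu ru]]] [cv [av [bv rv]]]].
- exists 1, 0, 0; rewrite rmorph1 scale1r !scale0r !addr0 subrr; exact: raises0.
- have [a [b eq_f]] := fE i; exists 0, a, b.
  rewrite feval_var eq_f scale0r add0r subrr; exact: raises0.
- exists (c * cu + cv), (c * au + av), (c * bu + bv); rewrite linearP /=.
  have := raises_linear c ru rv; congr (raises _ _).
  rewrite scalerBr addrACA -opprD; congr (_ - _).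
  by rewrite !scalerDl -!scalerA !scalerDr; do 2![rewrite addrACA; congr (_ + _)].
exists (cu * cv), (cu * av + cv * au), (cu * bv + cv * bu); rewrite rmorphM /=.
set U := feval f u in ru *; set V := feval f v in rv *.
set Lu := au *: x + bu *: y in ru *; set Lv := av *: x + bv *: y in rv *.
have rLu : raises 1 Lu.
  by apply: raises_linear => //; apply: raisesZ.
have rLv : raises 1 Lv.
  by apply: raises_linear => //; apply: raisesZ.
set Du := U - _ in ru; set Dv := V - _ in rv.
have -> : (cu * cv)%:A + ((cu * av + cv * au) *: x + (cu * bv + cv * bu) *: y) =
    cu%:A * cv%:A + cu%:A * Lv + Lu * cv%:A :> M.
  rewrite !mulr_algl mulr_algr scalerA -addrA /Lu /Lv !scalerDr !scalerA !scalerDl.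
  by rewrite addrACA.
have expand (C C' L L' : M) : U * V - (C * C' + C * L' + L * C') =
    C * (V - (C' + L')) + (U - (C + L)) * C' +
    (L * L' + (L * (V - (C' + L')) + (U - (C + L)) * (L' + (V - (C' + L'))))).
  by ncring.
rewrite expand -/Du -/Dv; clear expand.
rewrite mulr_algl mulr_algr; apply: raisesD; apply: raisesD.
- exact: raisesZ.
- exact: raisesZ.
- exact: (raisesM rLu rLv).
apply: raisesD; first by apply: raisesW (raisesM rLu rv).
rewrite mulrDr; apply: raisesD; first by apply: raisesW (raisesM ru rLv).
by apply: raisesW (raisesM ru rv).
Qed.

Lemma comm_shiftr (c : K) (z t : M) : comm z (c%:A + t) = comm z t.
Proof. by rewrite comm_linearr /comm mulr1 mul1r subrr scaler0 add0r. Qed.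

Lemma comm_shiftl (c : K) (z t : M) : comm (c%:A + t) z = comm t z.
Proof. by rewrite comm_linearl /comm mulr1 mul1r subrr scaler0 add0r. Qed.

Lemma raises_comm4_small (f : nat -> M) :
  (forall i, raises 1 (f i)) -> (forall i, w i < 4)%N ->
  forall u1 u2 u3 u4 : KX,
    comm (comm (comm (feval f u1) (feval f u2)) (feval f u3)) (feval f u4) = 0.
Proof.
move=> rf w4.
have split (u : KX) : exists c b, raises 1 b /\ feval f u = c%:A + b.
  elim/freealg_ind: u => [|i|k u v [c [b [rb equ]]] [c' [b' [rb' eqv]]]
                           |u v [c [b [rb equ]]] [c' [b' [rb' eqv]]]].
  - by exists 1, 0; rewrite rmorph1 scale1r addr0; split=> //; apply: raises0.
  - by exists 0, (f i); rewrite feval_var scale0r add0r.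
  - exists (k * c + c'), (k *: b + b'); split; first exact: raises_linear.
    by rewrite linearP /= equ eqv scalerDr scalerA addrACA -scalerDl.
  exists (c * c'), (c *: b' + (c' *: b + b * b')); split.
    apply: raises_linear => //; apply: raises_linear => //.
    exact: raisesW (raisesM rb rb').
  rewrite rmorphM /= equ eqv mulrDl !mulrDr !mulr_algl mulr_algr scalerA.
  by rewrite !addrA.
move=> u1 u2 u3 u4; apply: (@raises_eq0 4) => //.
have [c1 [b1 [r1 ->]]] := split u1; have [c2 [b2 [r2 ->]]] := split u2.
have [c3 [b3 [r3 ->]]] := split u3; have [c4 [b4 [r4 ->]]] := split u4.
rewrite !comm_shiftr comm_shiftl.
exact: (@raises_comm 3 1 _ _ (@raises_comm 2 1 _ _ (raises_comm r1 r2) r3) r4).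
Qed.

(** Up to degree 5, a fourfold commutator is a combination of fourfold commutators
    of x and y; these have degree at least 5 as well, since the triple ones have
    degree at least 4. As all weights are less than 5, degree 5 means zero. *)
Lemma raises_comm4 (x y : M) (f : nat -> M) :
  raises 1 x -> raises 1 y -> (forall i, exists a b, f i = a *: x + b *: y) ->
  (forall i, w i < 5)%N ->
  raises 4 (comm (comm x y) x) -> raises 4 (comm (comm x y) y) ->
  forall u1 u2 u3 u4 : KX,
    comm (comm (comm (feval f u1) (feval f u2)) (feval f u3)) (feval f u4) = 0.
Proof.
move=> rx ry fE w5 rxyx rxyy u1 u2 u3 u4; apply: (@raises_eq0 5) => //.
have split := raises_split rx ry fE.
have [c1 [a1 [b1 r1]]] := split u1; have [c2 [a2 [b2 r2]]] := split u2.
have [c3 [a3 [b3 r3]]] := split u3; have [c4 [a4 [b4 r4]]] := split u4.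
have rL a b : raises 1 (a *: x + b *: y).
  by apply: raises_linear => //; apply: raisesZ.
have commZl k (z t : M) : comm (k *: z) t = k *: comm z t.
  by rewrite /comm -scalerAl -scalerAr scalerBr.
have commZr k (z t : M) : comm z (k *: t) = k *: comm z t.
  by rewrite /comm -scalerAl -scalerAr scalerBr.
set L1 := a1 *: x + b1 *: y in r1; set L2 := a2 *: x + b2 *: y in r2.
set L3 := a3 *: x + b3 *: y in r3; set L4 := a4 *: x + b4 *: y in r4.
have [rL1 rL2 rL3 rL4] : [/\ raises 1 L1, raises 1 L2, raises 1 L3 & raises 1 L4].
  by split; apply: rL.
move: (feval f u1) (feval f u2) (feval f u3) (feval f u4) r1 r2 r3 r4 => U1 U2 U3 U4.
set D1 := U1 - _; set D2 := U2 - _; set D3 := U3 - _; set D4 := U4 - _ => r1 r2 r3 r4.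
have -> : U1 = c1%:A + (L1 + D1) by rewrite addrA /D1 addrC subrK.
have -> : U2 = c2%:A + (L2 + D2) by rewrite addrA /D2 addrC subrK.
have -> : U3 = c3%:A + (L3 + D3) by rewrite addrA /D3 addrC subrK.
have -> : U4 = c4%:A + (L4 + D4) by rewrite addrA /D4 addrC subrK.
rewrite !comm_shiftr comm_shiftl; apply: (@raises_comm 4 1); last first.
  by apply: raisesD => //; apply: raisesW r4.
have -> : comm (L1 + D1) (L2 + D2) =
  comm L1 L2 + (comm L1 D2 + comm D1 (L2 + D2)) by ncring.
set E := _ + comm D1 _.
have rE : raises 3 E.
  apply: raisesD; first exact: (raises_comm rL1 r2).
  by apply: (@raises_comm 2 1) => //; apply: raisesD => //; apply: raisesW r2.
have -> : comm (comm L1 L2 + E) (L3 + D3) =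
  comm (comm L1 L2) L3 + (comm (comm L1 L2) D3 + comm E (L3 + D3)) by ncring.
apply: raisesD; last apply: raisesD.
- have -> : comm L1 L2 = (a1 * b2 - b1 * a2) *: comm x y.
    have comm_xx (z : M) : comm z z = 0 by rewrite /comm subrr.
    have comm_yx : comm y x = - comm x y by rewrite /comm opprB.
    rewrite /L1 /L2 comm_linearl commZl !comm_linearr !commZr !comm_xx comm_yx.
    rewrite !scaler0 add0r addr0 scalerN scalerA scalerN scalerA.
    by rewrite scalerBl.
  rewrite commZl comm_linearr commZr; apply: raisesZ.
  by apply: raises_linear => //; apply: raisesZ.
- by apply: (@raises_comm 2 2) => //; apply: (raises_comm rL1 rL2).
by apply: (@raises_comm 3 1) => //; apply: raisesD => //; apply: raisesW r3.
Qed.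

End Weights.

Lemma delta_mxM d (i j k l : 'I_d.+1) :
  (delta_mx i j : 'M[K]_d.+1) * delta_mx k l = if j == k then delta_mx i l else 0.
Proof.
case: eqP => [->|/eqP jk]; rewrite -[LHS]/(_ *m _); first exact: mul_delta_mx.
exact: mul_delta_mx_0.
Qed.

Lemma delta_mx_neq0 d (i j : 'I_d.+1) : (delta_mx i j : 'M[K]_d.+1) != 0.
Proof.
apply/eqP => /matrixP /(_ i j); rewrite !mxE !eqxx /=.
by apply/eqP/oner_neq0.
Qed.

Lemma raises_delta d (w : 'I_d.+1 -> nat) k (i j : 'I_d.+1) :
  (w i + k <= w j)%N -> raises w k (delta_mx i j).
Proof.
move=> le_ij p q lt_pq; rewrite mxE; case: andP => // -[/eqP p_i /eqP q_j].
by move: lt_pq; rewrite p_i q_j ltnNge le_ij.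
Qed.

(** Strictly upper triangular matrices of size 4, with x = E01 + E23 and y = E12:
    all products of four factors vanish, but [x,y,x] = 2 E03. *)
Lemma model_comm3 : exists (d : nat) (x y : 'M[K]_d.+1),
  (forall f : nat -> 'M[K]_d.+1, 
    (forall i, exists a b, f i = a *: x + b *: y) ->
    forall u1 u2 u3 u4 : KX,
    comm (comm (comm (feval f u1) (feval f u2)) (feval f u3)) (feval f u4) = 0) /\
  comm (comm x y) x != 0.
Proof.
pose o k (lt_k : (k < 4)%N) : 'I_4 := Ordinal lt_k.
pose D i j lt_i lt_j : 'M[K]_4 := delta_mx (@o i lt_i) (@o j lt_j).
pose x := D 0%N 1%N isT isT + D 2%N 3%N isT isT.
pose y := D 1%N 2%N isT isT.
have xy : comm x y = D 0%N 2%N isT isT - D 1%N 3%N isT isT.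
  by rewrite /comm /x /y mulrDl mulrDr /D !delta_mxM /= !addr0 add0r.
have xyx : comm (comm x y) x = D 0%N 3%N isT isT *+ 2.
  rewrite xy /comm /x !mulrDl !mulrDr !mulNr !mulrN /D !delta_mxM /=.
  by rewrite !oppr0 !addr0 !add0r opprK mulr2n.
exists 3%N, x, y; split; last first.
  rewrite xyx; apply/eqP => /(mulrn_eq0_char0 charK0).
  exact/eqP/delta_mx_neq0.
have rx : raises (@nat_of_ord 4) 1 x by apply: raisesD; apply: raises_delta.
have ry : raises (@nat_of_ord 4) 1 y by apply: raises_delta.
move=> f fE; apply: (@raises_comm4_small _ (@nat_of_ord 4) f) => // i.
have [a [b ->]] := fE i; apply: raises_linear => //.
exact: raisesZ.
Qed.

(** The Heisenberg relation [x,y] = c, with c central, in a module where c^2 does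
    not act as zero. The module is a quotient of K[t,c] with x acting as
    multiplication by t and y as c d/dt, from the right; its basis 1, t, t^2, c, ct, c^2 has weights 0, 1, 2, 2, 3, 4. *)
Lemma model_comm2_sqr : exists (d : nat) (x y : 'M[K]_d.+1),
  (forall f : nat -> 'M[K]_d.+1, 
    (forall i, exists a b, f i = a *: x + b *: y) ->
    forall u1 u2 u3 u4 : KX,
    comm (comm (comm (feval f u1) (feval f u2)) (feval f u3)) (feval f u4) = 0) /\
  comm x y * comm x y != 0.
Proof.
pose w (i : 'I_6) := nth 0%N [:: 0; 1; 2; 2; 3; 4]%N i.
pose o k (lt_k : (k < 6)%N) : 'I_6 := Ordinal lt_k.
pose D i j lt_i lt_j : 'M[K]_6 := delta_mx (@o i lt_i) (@o j lt_j).
pose x := D 0%N 1%N isT isT + D 1%N 2%N isT isT + D 3%N 4%N isT isT.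
pose y := D 1%N 3%N isT isT + D 2%N 4%N isT isT *+ 2 + D 4%N 5%N isT isT.
have xy : comm x y = D 0%N 3%N isT isT + D 1%N 4%N isT isT + D 3%N 5%N isT isT.
  rewrite /comm /x /y mulr2n !mulrDl !mulrDr /D !delta_mxM /= !addr0 !add0r.
  by ncring.
have xyxy : comm x y * comm x y = D 0%N 5%N isT isT.
  by rewrite xy !mulrDl !mulrDr /D !delta_mxM /= !addr0 !add0r.
have xyx : comm (comm x y) x = 0.
  by rewrite xy /comm /x !mulrDl !mulrDr /D !delta_mxM /= !addr0 !add0r subrr.
have xyy : comm (comm x y) y = 0.
  by rewrite xy /comm /y mulr2n !mulrDl !mulrDr /D !delta_mxM /= !addr0 !add0r subrr.
exists 5%N, x, y; split; last by rewrite xyxy; apply: delta_mx_neq0.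
have rx : raises w 1 x by do !apply: raisesD; apply: raises_delta.
have ry : raises w 1 y by rewrite /y mulr2n; do !apply: raisesD; apply: raises_delta.
move=> f fE; apply: (raises_comm4 rx ry) => //; rewrite ?xyx ?xyy.
- by case=> -[|[|[|[|[|[|i]]]]]].
- exact: raises0.
exact: raises0.
Qed.

End Models.

(** * Linearization *)

Section Coefficients.
Variables (K : fieldType) (I : choiceType).
Implicit Types (f g : freealg K I) (s t : seq I).

(** Coefficients are indexed by plain lists instead of [fmonom], so that words can
    be permuted and mapped. *)
Definition coefw f s : K := f@_(FMonom s).

Lemma coefw_word s t : coefw (word K s) t = (s == t)%:R.
Proof. by rewrite /coefw /word mcoeffU. Qed.

Lemma coefw_linear s c f g : coefw (c *: f + g) s = c * coefw f s + coefw g s.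
Proof. by rewrite /coefw mcoeffD mcoeffZ. Qed.

Lemma coefwZ c f s : coefw (c *: f) s = c * coefw f s.
Proof. exact: mcoeffZ. Qed.

Lemma coefwB f g s : coefw (f - g) s = coefw f s - coefw g s.
Proof. exact: mcoeffB. Qed.

Lemma coefw0 s : coefw 0 s = 0.
Proof. exact: mcoeff0. Qed.

Lemma coefw_sum (J : Type) (r : seq J) (P : pred J) (F : J -> freealg K I) s :
  coefw (\sum_(j <- r | P j) F j) s = \sum_(j <- r | P j) coefw (F j) s.
Proof. exact: raddf_sum. Qed.

Lemma coefw_eq f g : (forall s, coefw f s = coefw g s) -> f = g.
Proof. by move=> fg; apply/malgP => w; rewrite -[w]fmK; apply: fg. Qed.

Lemma freealg_sum_words_on (L : seq (seq I)) f : uniq L ->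
  (forall s, coefw f s != 0 -> s \in L) ->
  f = \sum_(s <- L) coefw f s *: word K s.
Proof.
move=> uL fL; apply: coefw_eq => t; rewrite coefw_sum.
under eq_bigr do rewrite coefwZ coefw_word.
have [t_in|t_out] := boolP (t \in L).
  rewrite (bigD1_seq t) //= eqxx mulr1 big1 ?addr0 // => s /negPf ->.
  by rewrite mulr0.
rewrite big_seq big1 => [|s s_in].
  by apply/eqP; apply: contraNT t_out => /fL.
case: eqP => [st|]; last by rewrite mulr0.
by rewrite -st s_in in t_out.
Qed.

Lemma feval_sum_on (A : algType K) (a : I -> A) (L : seq (seq I)) f : uniq L ->
  (forall s, coefw f s != 0 -> s \in L) ->
  feval a f = \sum_(s <- L) coefw f s *: \prod_(i <- s) a i.
Proof.
move=> uL fL; rewrite {1}(freealg_sum_words_on uL fL) linear_sum.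
by apply: eq_bigr => s _; rewrite linearZ /= feval_word.
Qed.

Lemma finite_support f : exists L : seq (seq I),
  uniq L /\ forall s, coefw f s != 0 -> s \in L.
Proof.
exists [seq fmonom_val w | w <- finmap.enum_fset (msupp f)]; split.
  rewrite map_inj_uniq ?finmap.fset_uniq //; exact: val_inj.
move=> s fs; apply/mapP; exists (FMonom s) => //.
by have := mcoeff_neq0 f (FMonom s); rewrite -/(coefw f s) fs => /esym.
Qed.

Lemma coefw_var_mul i f s :
  coefw (fvar K i * f) s = if s is j :: s' then (i == j)%:R * coefw f s' else 0.
Proof.
elim/freealg_word_ind: f => [|c t f IH].
  by rewrite mulr0 coefw0; case: s => // j s; rewrite coefw0 mulr0.
have -> : fvar K i * (c *: word K t + f) = c *: word K (i :: t) + fvar K i * f.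
  by rewrite mulrDr -scalerAr !wordE big_cons.
rewrite coefw_linear {}IH; case: s => [|j s]; rewrite coefw_word ?mulr0 ?addr0 //.
rewrite coefw_linear coefw_word eqseq_cons mulrDr mulrCA; congr (_ * _ + _).
by case: eqP; case: eqP; rewrite ?mulr1 ?mulr0.
Qed.

End Coefficients.

Section Linearization.
Variables (K : fieldType) (charK0 : [pchar K] =i pred0).
Local Notation KX := (freealg K nat).
Implicit Types (f g : KX) (s : seq nat).

Definition specialize (j : nat) (c : KX) (f : KX) : KX :=
  feval (fun i => if i == j then c else fvar K i) f.

Lemma specialize_word_out j c s : j \notin s -> specialize j c (word K s) = word K s.
Proof.
move=> j_out; rewrite /specialize feval_word wordE; apply: eq_big_seq => i i_in.
by case: eqP => // i_j; rewrite -i_j i_in in j_out.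
Qed.

Lemma specialize_linear j c k f g :
  specialize j c (k *: f + g) = k *: specialize j c f + specialize j c g.
Proof. exact: linearP. Qed.

Lemma Id_specialize (A : algType K) j c f : Id A f -> Id A (specialize j c f).
Proof.
have [_ stable] := Id_Tideal A.
pose phi : {lrmorphism KX -> KX} := feval (fun i => if i == j then c else fvar K i).
exact: (stable phi).
Qed.

Lemma IdB (A : algType K) f g : Id A f -> Id A g -> Id A (f - g).
Proof. by move=> If Ig a; rewrite raddfB /= If Ig subrr. Qed.

Lemma IdD (A : algType K) f g : Id A f -> Id A g -> Id A (f + g).
Proof. by move=> If Ig a; rewrite raddfD /= If Ig addr0. Qed.

Lemma coefw_specialize0 j f s :
  coefw (specialize j 0 f) s = if j \in s then 0 else coefw f s.
Proof.
elim/freealg_word_ind: f => [|c t f IH].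
  by rewrite /specialize rmorph0 coefw0 if_same.
rewrite [in RHS]coefw_linear specialize_linear [LHS]coefw_linear.
transitivity (c * (if j \in t then 0 else coefw (word K t) s) +
              if j \in s then 0 else coefw f s).
  congr (_ * _ + _); last exact: IH.
  have [j_t|j_t] := boolP (j \in t); last by rewrite specialize_word_out.
  rewrite /specialize feval_word; case/splitPr: j_t => t1 t2.
  by rewrite big_cat /= big_cons eqxx /= mul0r mulr0 coefw0.
rewrite coefw_word; case: ifP => j_t; case: ifP => j_s; rewrite ?mulr0 ?add0r //.
  by case: eqP => [t_s|]; rewrite ?mulr0 ?add0r //; rewrite t_s j_s in j_t.
by case: eqP => [t_s|]; rewrite ?mulr0 ?add0r //; rewrite t_s j_s in j_t.
Qed.

(** The part of f made of the words in which all letters of L occur: subtracting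
    the value at x_j = 0 removes the words without x_j. Unlike an extraction of
    homogeneous components, this stays inside every T-ideal over any field. *)
Definition drop_missing (L : seq nat) (f : KX) : KX :=
  foldr (fun j g => g - specialize j 0 g) f L.

Lemma coefw_drop_missing L f s :
  coefw (drop_missing L f) s = if all (mem s) L then coefw f s else 0.
Proof.
elim: L => //= j L IH; rewrite coefwB coefw_specialize0 IH.
by case: (j \in s) => /=; rewrite ?subr0 ?subrr.
Qed.

Lemma Id_drop_missing (A : algType K) L f : Id A f -> Id A (drop_missing L f).
Proof.
by move=> If; elim: L => //= j L IH; apply: IdB => //; apply: Id_specialize.
Qed.

Definition multilinear s f := forall t, coefw f t != 0 -> perm_eq t s.

Section Polarization.
Variables (f : KX) (D N : nat).
Hypothesis f_size : forall s, coefw f s != 0 -> (size s <= D)%N.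
Hypothesis f_letters : forall s, coefw f s != 0 -> all (gtn N.+1) s.

(* The variable x_i becomes the sum of the new variables z_j, j < D, with c j = i. *)
Let spread (c : nat -> nat) (i : nat) : KX :=
  \sum_(j <- [seq j <- iota 0 D | c j == i]) fvar K j.

(** As f has degree at most D, a word in which all D new variables occur uses each
    of them once; the result is multilinear. *)
Definition polarize (c : nat -> nat) : KX :=
  drop_missing (iota 0 D) (feval (spread c) f).

Lemma coefw_spread_prod c t s :
  coefw (\prod_(i <- t) spread c i) s = (all (gtn D) s && (map c s == t))%:R.
Proof.
elim: t s => [|i t IH] s.
  have <- : word K [::] = \prod_(i <- [::]) spread c i by rewrite wordE !big_nil.
  rewrite coefw_word; case: s => [|j s] //=.
  by rewrite andbF.
rewrite big_cons big_distrl coefw_sum /=.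
case: s => [|j0 s].
  by rewrite big1 => [|j _]; rewrite ?coefw_var_mul // andbF.
under eq_bigr do rewrite coefw_var_mul IH.
rewrite -mulr_suml /= eqseq_cons.
have -> : \sum_(j <- [seq j <- iota 0 D | c j == i]) (j == j0)%:R =
    ((j0 < D)%N && (c j0 == i))%:R :> K.
  have uniq_r : uniq [seq j <- iota 0 D | c j == i] by rewrite filter_uniq ?iota_uniq.
  have [j0_in|j0_out] := boolP (j0 \in [seq j <- iota 0 D | c j == i]).
    rewrite (bigD1_seq j0) //= eqxx big1 ?addr0 => [|j /negPf -> //].
    by move: j0_in; rewrite mem_filter mem_iota add0n andbC => ->.
  rewrite big_seq big1 => [|j j_in].
    by move: j0_out; rewrite mem_filter mem_iota add0n andbC => /negPf ->.
  by case: eqP => // j_eq; rewrite -j_eq j_in in j0_out.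
by rewrite -natrM mulnb -!andbA; congr (_ && _)%:R; rewrite andbCA.
Qed.

Lemma coefw_spread c s :
  coefw (feval (spread c) f) s = if all (gtn D) s then coefw f (map c s) else 0.
Proof.
have [L [uL fL]] := finite_support f.
rewrite (feval_sum_on _ uL fL) coefw_sum.
under eq_bigr do rewrite coefwZ coefw_spread_prod.
have [cs_in|cs_out] := boolP (map c s \in L).
  rewrite (bigD1_seq (map c s)) //= eqxx andbT big1 ?addr0 => [|t].
    by case: ifP; rewrite ?mulr1 ?mulr0.
  by rewrite eq_sym => /negPf ->; rewrite andbF mulr0.
rewrite big_seq big1 => [|t t_in].
  case: ifP => // _; apply/esym/eqP; apply: contraNT cs_out => cs.
  exact: fL.
case: eqP => [t_eq|_]; last by rewrite andbF mulr0.
by rewrite t_eq t_in in cs_out.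
Qed.

Lemma coefw_polarize c s : 
  coefw (polarize c) s = if perm_eq s (iota 0 D) then coefw f (map c s) else 0.
Proof.
rewrite /polarize coefw_drop_missing coefw_spread.
have [s_perm|s_nperm] := boolP (perm_eq s (iota 0 D)).
  have -> : all (mem s) (iota 0 D).
    by apply/allP => i; rewrite /= (perm_mem s_perm).
  have -> // : all (gtn D) s.
  by apply/allP => i; rewrite (perm_mem s_perm) mem_iota.
case: ifP => // /allP s_sup; case: ifP => // /allP s_lt.
apply/eqP; apply: contraNT s_nperm => /f_size; rewrite size_map => s_size.
have s_sub : {subset iota 0 D <= s} by move=> i /s_sup.
have size_le : (size s <= size (iota 0 D))%N by rewrite size_iota.
apply: uniq_perm; last 2 first.
- exact: iota_uniq.
- by move=> i; apply/idP/idP => [/s_lt|/s_sub //]; rewrite mem_iota.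
exact: leq_size_uniq (iota_uniq _ _) s_sub size_le.
Qed.

Let letters (T : D.-tuple 'I_N.+1) : seq nat := map val T.

Definition top_part : KX :=
  \sum_(T : D.-tuple 'I_N.+1) coefw f (letters T) *: word K (letters T).

Lemma coefw_top_part s : coefw top_part s = if size s == D then coefw f s else 0.
Proof.
rewrite coefw_sum; under eq_bigr do rewrite coefwZ coefw_word.
have letters_inj : injective letters.
  by move=> T T' /(inj_map val_inj) /val_inj.
have [s_in|s_out] := boolP ((size s == D) && all (gtn N.+1) s).
  have /andP[s_D s_lt] := s_in; rewrite s_D.
  have size_T0 : size (map (@inord N) s) == D by rewrite size_map.
  pose T0 := Tuple size_T0.
  have T0E : letters T0 = s.
    rewrite /letters /= -map_comp map_id_in // => i i_in /=.
    by rewrite inordK //; have := allP s_lt i i_in.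
  rewrite (bigD1 T0) //= T0E eqxx mulr1 big1 ?addr0 // => T T_neq.
  by rewrite -T0E (inj_eq letters_inj) (negPf T_neq) mulr0.
rewrite big1 => [|T _].
  case: ifP => // s_D; apply/esym/eqP; apply: contraNT s_out => /f_letters ->.
  by rewrite s_D.
case: eqP => [T_s|]; last by rewrite mulr0.
case/negP: s_out; rewrite -T_s size_map size_tuple eqxx /=.
by apply/allP => _ /mapP[i _ ->]; rewrite /= ltn_ord.
Qed.

(** Each word of length D is recovered once for every order in which its D
    positions can be labelled by the new variables. *)
Lemma polarize_top_part (A : algType K) (a : nat -> A) :
  \sum_(T : D.-tuple 'I_N.+1)
    feval (fun j => a (nth 0%N (letters T) j)) (polarize (nth 0%N (letters T))) =
  feval a top_part *+ D`!.
Proof.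
pose F s := coefw f s *: \prod_(i <- s) a i.
have permuted w : w \in permutations (iota 0 D) ->
    \sum_(T : D.-tuple 'I_N.+1) F (map (nth 0%N (letters T)) w) =
    \sum_(T : D.-tuple 'I_N.+1) F (letters T).
  rewrite mem_permutations => w_perm.
  have /tuple_permP[p w_eq] : perm_eq w (iota_tuple D 0) by [].
  pose act (q : 'S_D) (T : D.-tuple 'I_N.+1) := [tuple tnth T (q i) | i < D].
  have actK q : cancel (act q) (act q^-1%g).
    by move=> T; apply: eq_from_tnth => i; rewrite !tnth_mktuple permKV.
  rewrite [RHS](reindex_inj (can_inj (actK p))); apply: eq_bigr => T _.
  congr F; rewrite w_eq /letters /act /= -!map_comp; apply: eq_map => i /=.
  rewrite (nth_map (tnth T i)) ?size_tuple.
    by rewrite (tnth_nth 0%N (iota_tuple D 0)) /= nth_iota // -tnth_nth.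
  by rewrite (tnth_nth 0%N (iota_tuple D 0)) /= nth_iota ?add0n ltn_ord.
have polE T : feval (fun j => a (nth 0%N (letters T) j)) (polarize (nth 0%N (letters T)))
    = \sum_(w <- permutations (iota 0 D)) F (map (nth 0%N (letters T)) w).
  rewrite (@feval_sum_on _ _ _ _ (permutations (iota 0 D))) ?permutations_uniq //.
    apply: eq_big_seq => w; rewrite mem_permutations => w_perm.
    by rewrite coefw_polarize w_perm /F big_map.
  move=> s; rewrite coefw_polarize mem_permutations.
  by case: ifP => //; rewrite eqxx.
under eq_bigr do rewrite polE.
rewrite exchange_big /= (eq_big_seq _ permuted) big_const_seq count_predT.
rewrite size_permutations ?iota_uniq // size_iota iter_addr_0; congr (_ *+ _).
rewrite /top_part linear_sum; apply: eq_bigr => T _.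
by rewrite linearZ /= feval_word.
Qed.

End Polarization.

(** Induction on the degree: the top homogeneous part of an identity of A is a
    combination of values of its polarizations, so it is an identity of A and of B,
    and can be subtracted. Characteristic zero serves to divide by D!. *)
Lemma Id_multilinear_sub (A B : algType K) :
  (forall s f, uniq s -> multilinear s f -> Id A f -> Id B f) -> Id A `<=` Id B.
Proof.
move=> sub_mult f.
have [N f_letters] : exists N, forall s, coefw f s != 0 -> all (gtn N.+1) s.
  have [L [_ fL]] := finite_support f.
  exists (\max_(i <- flatten L) i)%N => s /fL s_L; apply/allP => i i_s /=.
  rewrite ltnS; apply: (leq_bigmax_seq (F := id)) => //.
  by apply/flattenP; exists s.
have [D f_size] : exists D, forall s, coefw f s != 0 -> (size s < D)%N.
  have [L [_ fL]] := finite_support f.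
  exists (\max_(s <- L) size s).+1 => s /fL s_L; rewrite ltnS.
  exact: (leq_bigmax_seq (F := size)).
elim: D f f_letters f_size => [|D IH] f f_letters f_size IAf.
  have -> : f = 0.
    apply: coefw_eq => s; rewrite coefw0; apply/eqP.
    by apply: contraTT isT => /f_size.
  by move=> a; rewrite raddf0.
have f_le s : coefw f s != 0 -> (size s <= D)%N by move/f_size.
pose g := top_part f D N.
have polB T : Id A (polarize f D T) /\ Id B (polarize f D T).
  have IAp : Id A (polarize f D T).
    apply: Id_drop_missing; have [_ stable] := Id_Tideal A.
    by rewrite -[feval _ f]/((feval _ : {lrmorphism KX -> KX}) f); apply: stable.
  split=> //; apply: (sub_mult (iota 0 D)) => //; first exact: iota_uniq.
  by move=> t; rewrite coefw_polarize //; case: ifP => //; rewrite eqxx.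
have Ig (C : algType K) : (forall c, Id C (polarize f D c)) -> Id C g.
  move=> IC a; have := polarize_top_part N f_le a.
  rewrite big1 => [|T _]; last exact: IC.
  by rewrite -(prednK (fact_gt0 D)) => /esym /(mulrn_eq0_char0 charK0).
have IAg : Id A g by apply: Ig => c; case: (polB c).
have IBg : Id B g by apply: Ig => c; case: (polB c).
rewrite -(subrK g f); apply: IdD => //; apply: IH; last exact: IdB.
  move=> s; rewrite coefwB coefw_top_part //; case: ifP => _.
    by rewrite subrr eqxx.
  by rewrite subr0; apply: f_letters.
move=> s; rewrite coefwB coefw_top_part //; case: ifP => [|s_D].
  by rewrite subrr eqxx.
by rewrite subr0 ltn_neqAle s_D /=; apply: f_le.
Qed.

End Linearization.

(** * Reduction to commutators *)

Section CommutatorSpan.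
Variables (K : fieldType) (charK0 : [pchar K] =i pred0).
Variables (R : algType K) (X : nat -> R).
Implicit Types (f g h : R) (s t u v : seq nat).

(** Congruence modulo the T-ideal generated by [x1,x2,x3,x4], expressed through the
    homomorphisms to the algebras with N3. Coefficients found modulo this congruence
    can be used in all such algebras at once. *)
Definition nil3_eq f g := forall (A : algType K), lie_nil3 A ->
  forall phi : {lrmorphism R -> A}, phi f = phi g.

Inductive spanned (P : R -> Prop) : R -> Prop :=
| SpannedZero f : nil3_eq f 0 -> spanned P f
| SpannedAdd c h g f : P h -> spanned P g -> nil3_eq f (c *: h + g) -> spanned P f.

Lemma spanned_eq P f g : nil3_eq f g -> spanned P g -> spanned P f.
Proof.
move=> fg Pg; case: Pg fg => [g' g0 fg|c h g1 g' Ph Pg1 g'E fg].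
  by apply: SpannedZero => A nil3 h'; rewrite fg // g0.
by apply: SpannedAdd Ph Pg1 _ => A nil3 h'; rewrite fg // g'E.
Qed.

Lemma spanned0 P : spanned P 0.
Proof. exact: SpannedZero. Qed.

Lemma spanned_linear P c f g : spanned P f -> spanned P g -> spanned P (c *: f + g).
Proof.
move=> Pf Pg; elim: Pf => {f} [f f0|k h f' f Ph _ IH f_eq].
  by apply: spanned_eq Pg => A nil3 h'; rewrite linearP /= f0 // rmorph0 scaler0 add0r.
apply: (@SpannedAdd _ (c * k) h (c *: f' + g)) => // A nil3 h'.
by rewrite !linearP /= f_eq // linearP /= scalerDr scalerA addrA.
Qed.

Lemma spannedD P f g : spanned P f -> spanned P g -> spanned P (f + g).
Proof. by move=> Pf Pg; rewrite -[f]scale1r; apply: spanned_linear. Qed.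

Lemma spanned_in (P : R -> Prop) h : P h -> spanned P h.
Proof.
move=> Ph; apply: (@SpannedAdd _ 1 h 0) => //; first exact: spanned0.
by move=> A nil3 h'; rewrite scale1r addr0.
Qed.

Lemma spanned_map (P P' : R -> Prop) (phi : R -> R) :
  (forall f g, nil3_eq f g -> nil3_eq (phi f) (phi g)) ->
  (forall c f g, phi (c *: f + g) = c *: phi f + phi g) ->
  (forall h, P h -> spanned P' (phi h)) ->
  forall f, spanned P f -> spanned P' (phi f).
Proof.
move=> phi_eq phi_lin phiP f; elim=> {f} [f f0|c h g f Ph _ IH f_eq].
  apply: (spanned_eq (phi_eq _ _ f0)).
  have -> : phi 0 = 0.
    have := phi_lin (-1) 0 0; rewrite scaleN1r scaleN1r addNr => ->.
    by rewrite addNr.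
  exact: spanned0.
apply: (spanned_eq (phi_eq _ _ f_eq)); rewrite phi_lin.
by apply: spanned_linear => //; apply: phiP.
Qed.


Lemma spanned_sub (P P' : R -> Prop) :
  (forall h, P h -> P' h) -> forall f, spanned P f -> spanned P' f.
Proof.
move=> PP'; apply: (@spanned_map _ _ id) => // h Ph.
exact/spanned_in/PP'.
Qed.

Definition monom u : R := \prod_(i <- u) X i.

Lemma monom_cons i u : monom (i :: u) = X i * monom u.
Proof. exact: big_cons. Qed.

Lemma monom_cat u v : monom (u ++ v) = monom u * monom v.
Proof. exact: big_cat. Qed.

Definition comm_term v h :=
  (~~ odd (size v) /\ h = pair_prod (map X v)) \/
  exists a b c, v = [:: a; b; c] /\ h = comm (comm (X a) (X b)) (X c).

(** L lists the letters that have already been moved from the monomial into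
    commutators. *)
Definition mixed_term (L : seq nat) s h := exists u v g,
  [/\ perm_eq (u ++ v) s, all (predC (mem L)) u, comm_term v g & h = monom u * g].

Lemma spanned_mul_var L s i f : i \notin L ->
  spanned (mixed_term L s) f -> spanned (mixed_term L (i :: s)) (X i * f).
Proof.
move=> iL; apply: (@spanned_map _ _ ( *%R (X i))) =>
  {f} [f g fg A nil3 phi|c f g|_ [u [v [g [us uL vg ->]]]]].
- by rewrite !rmorphM /= (fg A nil3 phi).
- by rewrite mulrDr scalerAr.
apply: spanned_in; exists (i :: u), v, g; split=> //=.
- by rewrite perm_cons.
- by rewrite iL.
by rewrite !monom_cons mulrA.
Qed.

Lemma spanned_comm_word L i j w : all (predC (mem L)) w ->
  spanned (mixed_term L (j :: i :: w)) (comm (X j) (X i) * monom w).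
Proof.
elim: w => [|k w IH] /= => [_|/andP[kL wL]].
  apply: spanned_in; exists [::], [:: j; i], (comm (X j) (X i)); split=> //.
    by left; rewrite /= mulr1.
  by rewrite /monom big_nil mulr1 mul1r.
have -> : comm (X j) (X i) * monom (k :: w) =
    X k * (comm (X j) (X i) * monom w) + comm (comm (X j) (X i)) (X k) * monom w.
  by rewrite monom_cons; ncring.
have perm_k : perm_eq [:: k, j, i & w] [:: j, i, k & w].
  exact: permEl (perm_catCA [:: k] [:: j; i] w).
apply: spannedD.
  have := spanned_mul_var kL (IH wL); apply: spanned_sub => h [u [v [g [us uL vg ->]]]].
  by exists u, v, g; split=> //; apply: perm_trans perm_k.
apply: (@spanned_eq _ _ (monom w * comm (comm (X j) (X i)) (X k))).
  move=> A nil3 phi; rewrite !rmorphM !rmorph_comm.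
  by rewrite (comm3_central nil3).
apply: spanned_in; exists w, [:: j; i; k], (comm (comm (X j) (X i)) (X k)).
split=> //; first by rewrite perm_catC.
by right; exists j, i, k.
Qed.

Lemma spanned_comm_term L i j w v g : all (predC (mem L)) w -> comm_term v g ->
  spanned (mixed_term L (j :: i :: w ++ v)) (comm (X j) (X i) * (monom w * g)).
Proof.
move=> wL [[v_even ->]|[a [b [c [-> ->]]]]]; last first.
  apply: SpannedZero => A nil3 x; rewrite !rmorphM !rmorph_comm rmorph0.
  by rewrite (comm3_central nil3) mulrA (comm2_comm3 charK0 nil3) mul0r.
case: v v_even => [|b [|c v]] //= v_even.
  by rewrite mulr1 cats0; apply: spanned_comm_word.
apply: (@spanned_eq _ _ (monom w * (pair_prod (map X [:: j, i, b, c & v])))).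
  move=> A nil3 phi; rewrite /= !rmorphM !rmorph_comm !mulrA; congr (_ * _).
  have := pair_prod_mulC charK0 nil3 [:: phi (X j); phi (X i)] (phi (monom w))
     (phi (X b)) (phi (X c)).
  by rewrite /= mulr1.
apply: spanned_in; exists w, [:: j, i, b, c & v], (pair_prod (map X [:: j, i, b, c & v])).
split=> //; last by left; split; rewrite //= negbK.
exact: permEl (perm_catCA w [:: j; i] [:: b, c & v]).
Qed.

(** Moving x_i to the front of a monomial leaves the commutators of x_i with the
    letters it jumps over. *)
Lemma spanned_pull_var L i u1 u2 v g :
  all (predC (mem L)) u1 -> all (predC (mem L)) u2 -> comm_term v g ->
  spanned (mixed_term L (i :: u1 ++ u2 ++ v))
    (monom (u1 ++ i :: u2) * g - X i * (monom (u1 ++ u2) * g)).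
Proof.
move=> u1L u2L vg; elim: u1 u1L => [|j u1 IH] /= => [_|/andP[jL u1L]].
  rewrite monom_cons mulrA subrr; exact: spanned0.
have cons w : monom (j :: w) = X j * monom w by rewrite !monom_cons.
have -> : monom (j :: u1 ++ i :: u2) * g - X i * (monom (j :: u1 ++ u2) * g) =
   X j * (monom (u1 ++ i :: u2) * g - X i * (monom (u1 ++ u2) * g)) +
   comm (X j) (X i) * (monom (u1 ++ u2) * g) by rewrite !cons; ncring.
have perm_ij : perm_eq [:: j, i & u1 ++ u2 ++ v] [:: i, j & u1 ++ u2 ++ v].
  exact: permEl (perm_catCA [:: j] [:: i] (u1 ++ u2 ++ v)).
apply: spannedD.
  have := spanned_mul_var jL (IH u1L).
  apply: spanned_sub => h [u [v' [g' [us uL vg' ->]]]].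
  by exists u, v', g'; split=> //; apply: perm_trans perm_ij.
have := @spanned_comm_term L i j (u1 ++ u2) v g; rewrite all_cat u1L u2L -catA.
move=> /(_ isT vg); apply: spanned_sub => h [u [v' [g' [us uL vg' ->]]]].
by exists u, v', g'; split=> //; apply: perm_trans perm_ij.
Qed.

Variable set1 : nat -> {lrmorphism R -> R}.
Hypothesis set1X : forall i j, set1 i (X j) = if j == i then 1 else X j.

(** This kills the terms in which x_i stands alone at the front, and preserves those
    in which x_i occurs inside a commutator. *)
Definition proper_step i f : R := f - X i * set1 i f.

Lemma set1_monom_out i u : i \notin u -> set1 i (monom u) = monom u.
Proof.
move=> i_u; rewrite /monom rmorph_prod; apply: eq_big_seq => j j_u /=.
by rewrite set1X; case: eqP => // j_i; rewrite -j_i j_u in i_u.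
Qed.

Lemma set1_monom i u1 u2 : i \notin u1 -> i \notin u2 ->
  set1 i (monom (u1 ++ i :: u2)) = monom (u1 ++ u2).
Proof.
move=> i1 i2; rewrite !monom_cat monom_cons !rmorphM /= set1X eqxx mul1r.
by rewrite !set1_monom_out.
Qed.

Lemma set1_comm_term i v g : i \in v -> comm_term v g -> set1 i g = 0.
Proof.
have h1 : set1 i (X i) = 1 by rewrite set1X eqxx.
move=> i_v vg.
have comm1l (y : R) : comm 1 y = 0 by rewrite /comm mul1r mulr1 subrr.
have comm1r (y : R) : comm y 1 = 0 by rewrite /comm mul1r mulr1 subrr.
have comm0l (y : R) : comm 0 y = 0 by rewrite /comm mul0r mulr0 subrr.
case: vg => [[v_even ->]|[a [b [c [v_eq ->]]]]].
  rewrite rmorph_pair_prod -map_comp; case/splitPr: i_v v_even => v1 v2 v_even.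
  rewrite (eq_map (g := fun j => if j == i then 1 else X j)) => [|j]; last exact: set1X.
  rewrite map_cat /= eqxx pair_prod_one //.
  by rewrite size_cat /= !size_map; rewrite size_cat in v_even.
rewrite !rmorph_comm /=; move: i_v; rewrite v_eq !inE.
case/or3P => /eqP <-; rewrite h1 ?comm1l ?comm1r ?comm0l //.
Qed.

Lemma set1_comm_term_out i v g : i \notin v -> comm_term v g -> set1 i g = g.
Proof.
have hX j : j != i -> set1 i (X j) = X j by rewrite set1X => /negPf ->.
move=> i_v vg.
case: vg => [[v_even ->]|[a [b [c [v_eq ->]]]]].
  rewrite rmorph_pair_prod -map_comp; congr pair_prod; apply/eq_in_map => j j_v /=.
  by apply: hX; apply: contraNneq i_v => <-.
move: i_v; rewrite v_eq !inE !negb_or !(eq_sym i) => /and3P[ia ib ic].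
by rewrite !rmorph_comm /= !hX.
Qed.

(** If x_i occurs inside a commutator, setting x_i = 1 gives zero and the term is
    unchanged. If it occurs in the monomial, what remains is the difference of two
    positions of x_i, in which x_i has entered a commutator. *)
Lemma spanned_proper_step L s i f : uniq s -> i \in s ->
  spanned (mixed_term L s) f -> spanned (mixed_term (i :: L) s) (proper_step i f).
Proof.
move=> uniq_s i_s; apply: spanned_map => {f} [f g fg A nil3 phi|c f g|].
- rewrite /proper_step !rmorphB !rmorphM /= (fg A nil3 phi).
  by have := fg A nil3 (phi \o set1 i); rewrite /= => ->.
- by rewrite /proper_step linearP /= mulrDr -scalerAr scalerBr opprD addrACA.
move=> _ [u [v [g [us uL vg ->]]]].
have uniq_uv : uniq (u ++ v) by rewrite (perm_uniq us).
have [i_v|i_v] := boolP (i \in v).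
  have i_u : i \notin u.
    apply: contraL uniq_uv => i_u; rewrite cat_uniq negb_and; apply/orP; right.
    by rewrite negb_and negbK; apply/orP; left; apply/hasP; exists i.
  rewrite /proper_step rmorphM /= (set1_comm_term i_v vg) !mulr0 subr0.
  apply: spanned_in; exists u, v, g; split=> //.
  apply/allP => j j_u /=; rewrite inE negb_or.
  by have /= -> := allP uL j j_u; rewrite andbT; apply: contraNneq i_u => <-.
have i_u : i \in u by have := i_s; rewrite -(perm_mem us) mem_cat (negPf i_v) orbF.
case/splitPr: i_u us uL uniq_uv => u1 u2 us uL uniq_uv.
have [i1 i2] : i \notin u1 /\ i \notin u2.
  move: uniq_uv; rewrite cat_uniq => /andP[+ _].
  by rewrite cat_uniq /= negb_or => /and3P[_ /andP[i1 _] /andP[i2 _]].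
rewrite /proper_step rmorphM /= (set1_monom i1 i2) (set1_comm_term_out i_v vg).
move: uL; rewrite all_cat /= => /and3P[u1L _ u2L].
have avoid w : i \notin w -> all (predC (mem L)) w -> all (predC (mem (i :: L))) w.
  move=> i_w wL; apply/allP => j j_w /=; rewrite inE negb_or.
  by have /= -> := allP wL j j_w; rewrite andbT; apply: contraNneq i_w => <-.
have := spanned_pull_var i (avoid _ i1 u1L) (avoid _ i2 u2L) vg.
apply: spanned_sub => h [u' [v' [g' [us' uL' vg' ->]]]].
exists u', v', g'; split=> //; apply: perm_trans us' _.
by apply: perm_trans us; rewrite -catA; apply: permEl (perm_catCA [:: i] u1 (u2 ++ v)).
Qed.

Definition comm_span s := spanned (fun h => exists2 v, perm_eq v s & comm_term v h).

Lemma mixed_term_comm_span s f : spanned (mixed_term s s) f -> comm_span s f.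
Proof.
apply: spanned_sub => h [u [v [g [us uL vg ->]]]].
have u0 : u = [::].
  case: u us uL => // j u us /= /andP[/negP[]].
  by rewrite -(perm_mem us) mem_head.
rewrite u0 /= in us *; exists v => //.
by rewrite /monom big_nil mul1r.
Qed.

End CommutatorSpan.

Section MultilinearReduction.
Variables (K : fieldType) (charK0 : [pchar K] =i pred0).
Local Notation KX := (freealg K nat).
Local Notation X := (@fvar K nat).
Implicit Types (f g h : KX) (s t u v : seq nat).

Lemma multilinear_ind (s : seq nat) (P : KX -> Prop) : P 0 ->
  (forall c f g, P f -> P g -> P (c *: f + g)) ->
  (forall t, perm_eq t s -> P (word K t)) -> forall f, multilinear s f -> P f.
Proof.
move=> P0 Plin Pword f fs; have [L [uL fL]] := finite_support f.
rewrite (freealg_sum_words_on uL fL); elim: L {uL fL} => [|t L IH].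
  by rewrite big_nil.
rewrite big_cons; have [ft0|/fs/Pword Pt] := eqVneq (coefw f t) 0; last exact: Plin.
by rewrite ft0 scale0r add0r.
Qed.

Lemma multilinear_linear s c f g :
  multilinear s f -> multilinear s g -> multilinear s (c *: f + g).
Proof.
move=> fs gs t; rewrite coefw_linear; have [ft0|/fs //] := eqVneq (coefw f t) 0.
by rewrite ft0 mulr0 add0r; apply: gs.
Qed.

Lemma multilinear0 s : multilinear s (0 : KX).
Proof. by move=> t; rewrite coefw0 eqxx. Qed.

Lemma multilinear_word s t : perm_eq t s -> multilinear s (word K t).
Proof.
move=> ts t'; rewrite coefw_word; case: (t =P t') => [<- //|_].
by rewrite eqxx.
Qed.

Lemma specialize1_word i t1 t2 : i \notin t1 -> i \notin t2 ->
  specialize i 1 (word K (t1 ++ i :: t2)) = word K (t1 ++ t2).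
Proof.
move=> i1 i2; rewrite !wordE !big_cat big_cons /specialize !rmorphM /=.
rewrite feval_var eqxx mul1r -!wordE.
by rewrite -!/(specialize i 1 _) !specialize_word_out.
Qed.

Lemma multilinear_specialize1 s i f : uniq s -> i \in s ->
  multilinear s f -> multilinear (rem i s) (specialize i 1 f).
Proof.
move=> uniq_s i_s; move: f; apply: multilinear_ind => [|c g h Pg Ph|t ts].
- rewrite /specialize rmorph0; exact: multilinear0.
- by rewrite specialize_linear; apply: multilinear_linear.
have uniq_t : uniq t by rewrite (perm_uniq ts).
have i_t : i \in t by rewrite (perm_mem ts).
case/splitPr: i_t ts uniq_t => t1 t2 ts.
rewrite cat_uniq /= negb_or => /and3P[_ /andP[i1 _] /andP[i2 _]].
rewrite specialize1_word //; apply: multilinear_word.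
rewrite -(perm_cons i) -(permPr (perm_to_rem i_s)) perm_sym -(permPl ts).
by rewrite -[i :: _]cat1s -[i :: t1 ++ t2]cat1s perm_catCA.
Qed.

(** The instance of [proper_step] for the free algebra and its variables. *)
Definition drop_var i f : KX := f - X i * specialize i 1 f.

Lemma multilinear_drop_var s i f : uniq s -> i \in s ->
  multilinear s f -> multilinear s (drop_var i f).
Proof.
move=> uniq_s i_s fs; rewrite /drop_var addrC -scaleN1r.
apply: multilinear_linear => //.
have := multilinear_specialize1 uniq_s i_s fs.
move: (specialize i 1 f); apply: multilinear_ind => [|c g h Pg Ph|t ts].
- by rewrite mulr0; apply: multilinear0.
- have -> : X i * (c *: g + h) = c *: (X i * g) + X i * h by rewrite mulrDr scalerAr.
  exact: (multilinear_linear Pg Ph).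
have -> : X i * word K t = word K (i :: t) by rewrite !wordE big_cons.
apply: multilinear_word; rewrite perm_sym (permPl (perm_to_rem i_s)).
by rewrite perm_cons perm_sym.
Qed.

(** Setting x_i = 1 in an identity of A gives an identity of A of smaller degree,
    which by induction is an identity of B; so f may be replaced by
    f - x_i f(x_i = 1). Doing so for all variables leaves only commutators. *)
Lemma Id_comm_span_sub (A B : algType K) :
  (forall s f, uniq s -> comm_span X s f -> Id A f -> Id B f) ->
  forall s f, uniq s -> multilinear s f -> Id A f -> Id B f.
Proof.
move=> sub_span s; have [m] := ubnP (size s).
elim: m s => // m IH s size_s f uniq_s fs IAf.
have reduce L : {subset L <= s} -> exists f', [/\ multilinear s f', Id A f',
    Id B f' -> Id B f & spanned (mixed_term X L s) f'].
  elim: L => [|i L IHL] Ls.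
    exists f; split=> //; move: f fs {IAf}; apply: multilinear_ind.
    - exact: spanned0.
    - by move=> c f g; apply: spanned_linear.
    move=> t ts; apply: spanned_in; exists t, [::], 1; split.
    - by rewrite cats0.
    - exact/allP.
    - by left.
    exact: etrans (wordE K t) (esym (mulr1 _)).
  have i_s : i \in s by apply: Ls; rewrite mem_head.
  have [|f' [f's IAf' IBf' spf']] := IHL.
    by move=> j j_L; apply: Ls; rewrite inE j_L orbT.
  have IAsp : Id A (specialize i 1 f') by apply: Id_specialize.
  have IBsp : Id B (specialize i 1 f').
    apply: (IH (rem i s)) => //.
    - rewrite size_rem //; by case: (s) i_s size_s.
    - exact: rem_uniq.
    exact: multilinear_specialize1.
  have mulI (C : algType K) g : Id C g -> Id C (X i * g).
    by move=> Ig a; rewrite rmorphM /= Ig mulr0.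
  exists (drop_var i f'); split.
  - exact: multilinear_drop_var.
  - by apply: IdB => //; apply: mulI.
  - move=> IBstep; apply: IBf'; rewrite -[f'](subrK (X i * specialize i 1 f')).
    exact: IdD IBstep (mulI _ _ IBsp).
  pose set1 j : {lrmorphism KX -> KX} := feval (fun k => if k == j then 1 else X k).
  have set1X j k : set1 j (X k) = if k == j then 1 else X k by apply: feval_var.
  exact: (spanned_proper_step charK0 set1X uniq_s i_s spf').
have [|f' [_ IAf' IBf' spf']] := reduce s; first by move=> i.
apply: IBf'; exact: (sub_span s f' uniq_s (mixed_term_comm_span spf') IAf').
Qed.

End MultilinearReduction.

(** * Normal forms of commutator polynomials *)

Section NormalForms.
Variables (K : fieldType) (charK0 : [pchar K] =i pred0).
Variables (R : algType K) (X : nat -> R).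
Implicit Types (f g h : R) (s v : seq nat).

Lemma spanned_elim (P Q : R -> Prop) :
  (forall f g, nil3_eq f g -> Q g -> Q f) -> Q 0 ->
  (forall c f g, Q f -> Q g -> Q (c *: f + g)) ->
  (forall h, P h -> Q h) -> forall f, spanned P f -> Q f.
Proof.
move=> Qeq Q0 Qlin PQ f; elim=> {f} [f f0|c h g f Ph _ Qg f_eq].
  exact: Qeq f0 Q0.
by apply: Qeq f_eq _; apply: Qlin => //; apply: PQ.
Qed.

Lemma nil3_eq_trans f g h : nil3_eq f g -> nil3_eq g h -> nil3_eq f h.
Proof. by move=> fg gh A nil3 phi; rewrite (fg A nil3 phi); apply: gh. Qed.

Lemma nil3_eq_linear c f g f' g' : nil3_eq f f' -> nil3_eq g g' ->
  nil3_eq (c *: f + g) (c *: f' + g').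
Proof.
move=> ff' gg' A nil3 phi.
by rewrite !linearP /= (ff' A nil3 phi) (gg' A nil3 phi).
Qed.

Lemma comm_span_odd s f : odd (size s) -> size s != 3%N ->
  comm_span X s f -> nil3_eq f 0.
Proof.
move=> s_odd s3; apply: (spanned_elim (Q := fun f => nil3_eq f 0)) =>
  {f} [f g||c f g f0 g0|h [v vs]].
- exact: nil3_eq_trans.
- by [].
- have := nil3_eq_linear c f0 g0; rewrite scaler0 addr0; exact: id.
case=> [[v_even _]|[a [b [c [v_eq _]]]]]; have := perm_size vs.
  by move=> v_s; rewrite v_s s_odd in v_even.
by rewrite v_eq => s_3; rewrite -s_3 in s3.
Qed.

(** The sign depends on the permutation only, not on the algebra, as is needed to
    find a coefficient modulo [nil3_eq]. *)
Lemma pair_prod_perm v s : ~~ odd (size s) -> size s != 4%N -> perm_eq v s ->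
  exists b : bool, forall (A : algType K), lie_nil3 A -> forall y : nat -> A,
    pair_prod (map y v) = (-1) ^+ b * pair_prod (map y s).
Proof.
move=> s_even s4 vs.
have /tuple_permP[p v_eq] : perm_eq v (in_tuple s) by [].
exists (odd_perm p) => A nil3 y.
pose x (i : 'I_(size s)) := y (tnth (in_tuple s) i).
have := pair_prod_cat_alternating charK0 nil3 (r := [::]) x p.
rewrite addn0 !cats0 => /(_ s_even s4).
have -> : codom (x \o p) = map y v.
  by rewrite v_eq codomE /= -map_comp; apply: eq_map.
have -> // : codom x = map y s.
by rewrite codomE -[LHS]/(map (y \o tnth (in_tuple s)) _) map_comp map_tnth_enum.
Qed.

Section Evaluation.
Variables (A : algType K) (phi : {lrmorphism R -> A}) (y : nat -> A).
Hypothesis phiX : forall i, phi (X i) = y i.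

Lemma lrmorph_scale_pair_prod c s :
  phi (c *: pair_prod (map X s)) = c *: pair_prod (map y s).
Proof.
rewrite linearZ /= rmorph_pair_prod -map_comp; congr (_ *: pair_prod _).
exact: eq_map.
Qed.

Lemma lrmorph_comm3 k l a b c :
  phi (k *: comm (comm (X a) (X b)) (X c) + l *: comm (comm (X a) (X c)) (X b)) =
  k *: comm (comm (y a) (y b)) (y c) + l *: comm (comm (y a) (y c)) (y b).
Proof. by rewrite linearP /= linearZ /= !rmorph_comm /= !phiX. Qed.

Lemma lrmorph_comm4 k l m a b c d :
  phi (k *: (comm (X a) (X b) * comm (X c) (X d)) +
       (l *: (comm (X a) (X c) * comm (X b) (X d)) +
        m *: (comm (X a) (X d) * comm (X b) (X c)))) =
  k *: (comm (y a) (y b) * comm (y c) (y d)) +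
  (l *: (comm (y a) (y c) * comm (y b) (y d)) +
   m *: (comm (y a) (y d) * comm (y b) (y c))).
Proof.
by rewrite linearP /= linearP /= linearZ /= !rmorphM !rmorph_comm /= !phiX.
Qed.

End Evaluation.

Lemma comm_span_even s f : ~~ odd (size s) -> size s != 4%N ->
  comm_span X s f -> exists c, nil3_eq f (c *: pair_prod (map X s)).
Proof.
move=> s_even s4.
apply: (spanned_elim
  (Q := fun f => exists c, nil3_eq f (c *: pair_prod (map X s)))) =>
  {f} [f g fg [c gc]||c f g [a fa] [b gb]|h [v vs]].
- by exists c; apply: nil3_eq_trans gc.
- by exists 0; rewrite scale0r.
- exists (c * a + b); have := nil3_eq_linear c fa gb.
  by rewrite scalerDl -scalerA.
case=> [[_ ->]|[a [b [c [v_eq _]]]]]; last first.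
  by have := perm_size vs; rewrite v_eq => s_3; rewrite -s_3 in s_even.
have [b pairs] := pair_prod_perm s_even s4 vs.
exists ((-1) ^+ b) => A nil3 phi; rewrite linearZ /= !rmorph_pair_prod -!map_comp.
by rewrite pairs // scaler_sign mulr_sign.
Qed.

(** [b,c,a] is eliminated by the Jacobi identity. *)
Lemma comm_span3 a b c f : comm_span X [:: a; b; c] f -> exists k l,
  nil3_eq f (k *: comm (comm (X a) (X b)) (X c) + l *: comm (comm (X a) (X c)) (X b)).
Proof.
apply: (spanned_elim (Q := fun f => exists k l, nil3_eq f
  (k *: comm (comm (X a) (X b)) (X c) + l *: comm (comm (X a) (X c)) (X b)))) =>
  {f} [f g fg [k [l gkl]]||c' f g [k [l fkl]] [k' [l' gkl']]|h [v vs]].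
- by exists k, l; apply: nil3_eq_trans gkl.
- by exists 0, 0; rewrite !scale0r addr0.
- exists (c' * k + k'), (c' * l + l'); have := nil3_eq_linear c' fkl gkl'.
  by rewrite !scalerDl -!scalerA scalerDr addrACA.
case=> [[v_even _]|[a' [b' [c'' [v_eq ->]]]]].
  by rewrite (perm_size vs) in v_even.
have /(perm_iotaP 0%N)[t t_perm t_eq] := vs; rewrite /= in t_perm t_eq.
have t_lt : all (gtn 3) t by rewrite (perm_all _ t_perm).
move: t t_perm t_lt t_eq; rewrite v_eq.
case=> [//|i [//|j [//|k [|//]]]].
case: i => [|[|[|i]]] //; case: j => [|[|[|j]]] //;
  case: k => [|[|[|k]]] // _ _ [-> -> ->] /=.
(* One alternative for each of the six orders of the three letters. *)
all: do [ by exists 1, 0 => A nil3 phi; rewrite scale1r scale0r addr0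
  | by exists (-1), 0 => A nil3 phi; rewrite scaleN1r scale0r addr0; congr (phi _); ncring
  | by exists 0, 1 => A nil3 phi; rewrite scale1r scale0r add0r
  | by exists 0, (-1) => A nil3 phi; rewrite scaleN1r scale0r add0r; congr (phi _); ncring
  | by exists (-1), 1 => A nil3 phi; rewrite scaleN1r scale1r; congr (phi _); ncring
  | by exists 1, (-1) => A nil3 phi; rewrite scaleN1r scale1r; congr (phi _); ncring ].
Qed.

Lemma nil3_eq_comm2 (x y z t : R) :
  nil3_eq (comm x y * comm z t) (comm z t * comm x y).
Proof.
move=> A nil3 phi; rewrite !rmorphM !rmorph_comm; exact: comm2_commute.
Qed.

(** Solves one of the 24 cases below: up to sign and order of the two factors, the
    product is one of three. *)
Ltac product4 :=
  let nil3 := fresh in let phi := fresh in move=> ? nil3 phi;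
  rewrite ?(scale1r, scaleN1r, scale0r) ?addr0 ?add0r;
  first [ by [] | by congr (phi _); ncring
        | by apply: etrans (nil3_eq_comm2 _ _ _ _ nil3 phi) _
        | by apply: etrans (nil3_eq_comm2 _ _ _ _ nil3 phi) _;
             congr (phi _); ncring ].

Lemma comm_span4 a b c d f : comm_span X [:: a; b; c; d] f -> exists k l m,
  nil3_eq f (k *: (comm (X a) (X b) * comm (X c) (X d)) +
             (l *: (comm (X a) (X c) * comm (X b) (X d)) +
              m *: (comm (X a) (X d) * comm (X b) (X c)))).
Proof.
apply: (spanned_elim (Q := fun f => exists k l m, nil3_eq f 
  (k *: (comm (X a) (X b) * comm (X c) (X d)) +
             (l *: (comm (X a) (X c) * comm (X b) (X d)) +
              m *: (comm (X a) (X d) * comm (X b) (X c)))))) =>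
  {f} [f g fg [k [l [m gkl]]]||c' f g [k [l [m fkl]]] [k' [l' [m' gkl']]]|h [v vs]].
- by exists k, l, m; apply: nil3_eq_trans gkl.
- by exists 0, 0, 0; rewrite !scale0r !addr0.
- exists (c' * k + k'), (c' * l + l'), (c' * m + m'); have := nil3_eq_linear c' fkl gkl'.
  congr (nil3_eq _ _); rewrite !scalerDl -!scalerA !scalerDr addrACA; congr (_ + _).
  exact: addrACA.
case=> [[_ ->]|[a' [b' [c'' [v_eq _]]]]]; last first.
  by have := perm_size vs; rewrite v_eq.
have /(perm_iotaP 0%N)[t t_perm ->] := vs; rewrite /= in t_perm *.
have t_lt : all (gtn 4) t by rewrite (perm_all _ t_perm).
have t_size := perm_size t_perm.
case: t t_perm t_lt t_size => [|i [|j [|k [|l [|? ?]]]]] //.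
case: i => [|[|[|[|i]]]] //; case: j => [|[|[|[|j]]]] //;
  case: k => [|[|[|[|k]]]] //; case: l => [|[|[|[|l]]]] // _ _ _ /=; rewrite mulr1.
all: first
  [ by exists 1, 0, 0; product4 | by exists (-1), 0, 0; product4
  | by exists 0, 1, 0; product4 | by exists 0, (-1), 0; product4
  | by exists 0, 0, 1; product4 | by exists 0, 0, (-1); product4 ].
Qed.

End NormalForms.

(** * Comparison of identities *)

Section Comparison.
Variables (K : fieldType) (charK0 : [pchar K] =i pred0).
Variables (n : nat) (n_ge2 : (2 <= n)%N) (n_even : ~~ odd n).
Local Notation KX := (freealg K nat).
Local Notation X := (@fvar K nat).
Local Notation F := (@relfree K n 3 isT).
Implicit Types (f g : KX) (s : seq nat).

Lemma Id_nil3_eq (A : algType K) f g : lie_nil3 A -> nil3_eq f g -> Id A g -> Id A f.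
Proof. by move=> nil3 fg Ig a; apply: etrans (fg A nil3 (feval a)) (Ig a). Qed.

(** The evaluations of K<X> are handled as abstract homomorphisms, known through
    their values on the variables. *)
Lemma lrmorph_model (A : algType K) (y : nat -> A) (r : nat -> nat) f :
  (forall i, r i < n)%N ->
  (forall u v w t : KX, 
    comm (comm (comm (feval y u) (feval y v)) (feval y w)) (feval y t) = 0) ->
  Id F f -> exists2 phi : {lrmorphism KX -> A}, phi f = 0 &
    forall i, phi (X i) = y (r i).
Proof.
move=> r_lt nil3 If; pose r' i := Ordinal (r_lt i).
exists (feval (fun i => y (r' i))); last by move=> i; apply: feval_var.
exact: Id_relfree_model.
Qed.

Lemma grassmann_model s f : uniq s -> (size s <= n)%N -> Id F f ->
  exists (d : nat) (e : nat -> 'M[K]_d.+1) (phi : {lrmorphism KX -> 'M[K]_d.+1}),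
  [/\ forall i j, e i * e j = - (e j * e i), \prod_(i <- iota 0 (size s)) e i != 0,
      phi f = 0 & forall i, phi (X i) = e (index i s %% n)%N].
Proof.
move=> uniq_s s_le If; have [d [e [anti e_neq0]]] := grassmann_matrices K n.
have r_lt i : (index i s %% n < n)%N by rewrite ltn_pmod // (leq_trans _ n_ge2).
have nil3 (u v w t : KX) :
    comm (comm (comm (feval e u) (feval e v)) (feval e w)) (feval e t) = 0.
  by rewrite (anticommuting_nil2 anti) /comm mul0r mulr0 subrr.
have [phi phif phiX] := lrmorph_model r_lt nil3 If.
exists d, e, phi; split=> //.
apply: contraNneq e_neq0; rewrite -(big_mkord xpredT (fun i => e i)).
rewrite /index_iota subn0 -(subnKC s_le) iotaD big_cat /= => ->.
by rewrite mul0r.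
Qed.

Lemma index_nth_mod s k : uniq s -> (size s <= n)%N -> (k < size s)%N ->
  (index (nth 0%N s k) s %% n)%N = k.
Proof.
move=> uniq_s s_le lt_k; rewrite index_uniq // modn_small //.
exact: leq_trans lt_k s_le.
Qed.

Lemma two_letter_model d (x y : 'M[K]_d.+1) :
  (forall f : nat -> 'M[K]_d.+1,
    (forall i, exists a b, f i = a *: x + b *: y) ->
    forall u1 u2 u3 u4 : KX,
    comm (comm (comm (feval f u1) (feval f u2)) (feval f u3)) (feval f u4) = 0) ->
  forall (S : pred nat) g, Id F g -> exists2 phi : {lrmorphism KX -> 'M[K]_d.+1},
    phi g = 0 & forall i, phi (X i) = if S i then y else x.
Proof.
move=> nil3 S g Ig; pose z i := if i == 0%N then x else if i == 1%N then y else 0.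
have zE i : exists a b, z i = a *: x + b *: y.
  rewrite /z; case: eqP => _; first by exists 1, 0; rewrite scale1r scale0r addr0.
  case: eqP => _; first by exists 0, 1; rewrite scale1r scale0r add0r.
  by exists 0, 0; rewrite !scale0r addr0.
have r_lt i : (S i < n)%N by apply: leq_trans n_ge2; case: (S i).
have [phi phig phiX] := lrmorph_model r_lt (nil3 z zE) Ig.
by exists phi => // i; rewrite phiX /z; case: (S i).
Qed.

Variables (B : algType K) (nil3B : lie_nil3 B) (stdB : sats_standard B (n + 2)).

Let n2_even : ~~ odd (n + 2). Proof. by rewrite oddD addbF. Qed.

Lemma scale_nil3_eq0 (R : lmodType K) (v : R) c : c *: v = 0 -> v != 0 -> c = 0.
Proof. by move/eqP; rewrite scaler_eq0 => /orP[/eqP //|->]. Qed.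

(** As n is even, an even degree m > n is at least n + 2. *)
Lemma Id_sub_even s f : uniq s -> ~~ odd (size s) -> size s != 4%N ->
  comm_span X s f -> Id F f -> Id B f.
Proof.
move=> uniq_s s_even s4 sp IF; have [c fc] := comm_span_even charK0 s_even s4 sp.
have IFc : Id F (c *: pair_prod (map X s)).
  apply: (Id_nil3_eq (@relfree_nil3 K n) _ IF) => A nil3 phi.
  by rewrite (fc A nil3 phi).
apply: (Id_nil3_eq nil3B fc) => a.
apply: etrans (lrmorph_scale_pair_prod (feval_var a) c s) _.
have [s_le|lt_s] := leqP (size s) n; last first.
  rewrite (pair_prod_eq0_standard charK0 nil3B n2_even) ?scaler0 ?size_map //.
  rewrite addn2 ltn_neqAle lt_s andbT; apply: contraNneq s_even => <-.
  by rewrite /= n_even.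
have [d [e [phi [anti e_neq0 phif phiX]]]] := grassmann_model uniq_s s_le IFc.
have c0 : c = 0.
  move: phif; rewrite (lrmorph_scale_pair_prod phiX).
  have -> : map (fun i => e (index i s %% n)%N) s = map e (iota 0 (size s)).
    apply: (@eq_from_nth _ 0); first by rewrite !size_map size_iota.
    move=> k; rewrite size_map => lt_k.
    by rewrite (nth_map 0%N) // (nth_map 0%N) ?size_iota // nth_iota // index_nth_mod.
  rewrite (pair_prod_anticommuting _ anti) ?size_iota // => c_eq.
  apply: scale_nil3_eq0 c_eq _; apply: contraNneq e_neq0.
  by move/(mulrn_exp2_eq0 charK0)->.
by rewrite c0 scale0r.
Qed.

(** The substitutions x, y, x and x, x, y for a, b, c isolate the two coefficients. *)
Lemma Id_sub3 a b c f : uniq [:: a; b; c] -> comm_span X [:: a; b; c] f ->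
  Id F f -> Id B f.
Proof.
rewrite /= !inE negb_or andbT => /andP[/andP[ab ac] bc] sp IF.
have [k [l fkl]] := comm_span3 sp.
set g := (k *: _ + _) in fkl.
have IFg : Id F g.
  apply: (Id_nil3_eq (@relfree_nil3 K n) _ IF) => A nil3 phi.
  by rewrite (fkl A nil3 phi).
have [d [x [y [nil3 xyx_neq0]]]] := model_comm3 charK0.
have comm_xx (z : 'M[K]_d.+1) : comm z z = 0 by rewrite /comm subrr.
have comm0 (z : 'M[K]_d.+1) : comm 0 z = 0 by rewrite /comm mul0r mulr0 subrr.
have k0 : k = 0.
  have [phi phig phiX] := two_letter_model nil3 (pred1 b) IFg.
  move: phig; rewrite (lrmorph_comm3 phiX) /= eqxx (negPf ab) eq_sym (negPf bc).
  by rewrite comm_xx comm0 scaler0 addr0 => /scale_nil3_eq0; apply.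
have l0 : l = 0.
  have [phi phig phiX] := two_letter_model nil3 (pred1 c) IFg.
  move: phig; rewrite (lrmorph_comm3 phiX) /= eqxx (negPf ac) (negPf bc).
  by rewrite comm_xx comm0 scaler0 add0r => /scale_nil3_eq0; apply.
apply: (Id_nil3_eq nil3B fkl) => z.
apply: etrans (lrmorph_comm3 (feval_var z) k l a b c) _.
by rewrite k0 l0 !scale0r addr0.
Qed.

(** The substitutions x, y, x, y and x, x, y, y show that f is a multiple of the
    alternating form [a,b][c,d] - [a,c][b,d] + [a,d][b,c]. This form vanishes in B if
    n = 2; if n >= 4 its value 12 e0 e1 e2 e3 in the Grassmann algebra shows that the
    multiple is zero. *)
Lemma Id_sub4 a b c d f : uniq [:: a; b; c; d] -> comm_span X [:: a; b; c; d] f ->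
  Id F f -> Id B f.
Proof.
move=> uniq_s sp IF; have := uniq_s; rewrite /= !inE !negb_or andbT.
case/and3P => /and3P[ab ac ad] /andP[bc bd] cd.
have [k [l [m fklm]]] := comm_span4 sp.
set g := (k *: _ + _) in fklm.
have IFg : Id F g.
  apply: (Id_nil3_eq (@relfree_nil3 K n) _ IF) => A nil3 phi.
  by rewrite (fklm A nil3 phi).
have [km lm] : k = m /\ l = - m.
  have [e [x [y [nil3 sqr_neq0]]]] := model_comm2_sqr K.
  have comm_xx (z : 'M[K]_e.+1) : comm z z = 0 by rewrite /comm subrr.
  have comm_yx : comm y x = - comm x y by rewrite /comm opprB.
  split; apply/eqP; [rewrite -subr_eq0|rewrite -addr_eq0]; apply/eqP.
    have [phi phig phiX] := two_letter_model nil3 (pred2 b d) IFg.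
    move: phig; rewrite (lrmorph_comm4 phiX) /= !eqxx (negPf ab) (negPf ad) orbT /=.
    rewrite (eq_sym c) (negPf bc) (negPf cd) /= comm_xx mul0r scaler0 add0r.
    by rewrite comm_yx mulrN scalerN -scalerBl => /scale_nil3_eq0; apply.
  have [phi phig phiX] := two_letter_model nil3 (pred2 c d) IFg.
  move: phig; rewrite (lrmorph_comm4 phiX) /= !eqxx.
  rewrite (negPf ac) (negPf ad) (negPf bc) (negPf bd) orbT /=.
  by rewrite comm_xx mul0r scaler0 add0r -scalerDl => /scale_nil3_eq0; apply.
apply: (Id_nil3_eq nil3B fklm) => z.
apply: etrans (lrmorph_comm4 (feval_var z) k l m a b c d) _.
rewrite km lm scaleNr addrA -scalerBr -scalerDr.
have [n4|lt_n4] := leqP 4 n; last first.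
  have n2 : (n + 2 = 4)%N.
    by move: n_ge2 n_even lt_n4; case: (n) => [|[|[|[|n']]]].
  by rewrite pair_prod4_standard ?scaler0 // -n2.
have [e [E [phi [anti E_neq0 phig phiX]]]] := grassmann_model uniq_s n4 IFg.
suff -> : m = 0 by rewrite scale0r.
have := lrmorph_comm4 phiX k l m a b c d; rewrite -/g phig km lm.
have idx k' := @index_nth_mod [:: a; b; c; d] k' uniq_s n4.
rewrite (idx 0%N isT) (idx 1%N isT) (idx 2%N isT) (idx 3%N isT).
set e0 := E 0%N; set e1 := E 1%N; set e2 := E 2%N; set e3 := E 3%N.
have pairE i j : comm (E i) (E j) = (E i * E j) *+ 2.
  by rewrite /comm (anti j i) opprK mulr2n.
rewrite !pairE !mulrnAl !mulrnAr -!mulrnA.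
have -> : e0 * e2 * (e1 * e3) = - (e0 * e1 * (e2 * e3)).
  by rewrite -!mulrA (mulrA e2) (anti 2%N 1%N) mulNr -!mulrA mulrN.
have -> : e0 * e3 * (e1 * e2) = e0 * e1 * (e2 * e3).
  rewrite -!mulrA (mulrA e3) (anti 3%N 1%N) mulNr -!mulrA (anti 3%N 2%N).
  by rewrite !mulrN opprK.
move: E_neq0; rewrite /= !big_cons big_nil mulr1 -/e0 -/e1 -/e2 -/e3 !mulrA => E_neq0.
rewrite mulNrn scalerN scaleNr opprK -!scalerDl => /esym m0.
have : m + (m + m) = 0.
  apply: scale_nil3_eq0 m0 _; apply: contraNneq E_neq0.
  by move/(mulrn_eq0_char0 charK0)->.
rewrite -[m + _]/(m *+ 3) => /eqP.
by rewrite -mulr_natr mulf_eq0 (negPf (natK_neq0 charK0 2)) orbF => /eqP.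
Qed.

Lemma Id_relfree_sub : Id F `<=` Id B.
Proof.
apply: (Id_multilinear_sub charK0); apply: (Id_comm_span_sub charK0) => s f uniq_s sp IF.
have [s_odd|s_even] := boolP (odd (size s)).
  have [s3|s3] := eqVneq (size s) 3%N; last first.
    apply: (Id_nil3_eq nil3B (comm_span_odd s_odd s3 sp)) => a; exact: rmorph0.
  case: s s3 {s_odd} uniq_s sp => [//|a [//|b [//|c [|//]]]] _ uniq_s sp.
  exact: Id_sub3 uniq_s sp IF.
have [s4|s4] := eqVneq (size s) 4%N; last exact: Id_sub_even sp IF.
case: s s4 {s_even} uniq_s sp => [//|a [//|b [//|c [//|d [|//]]]]] _ uniq_s sp.
exact: Id_sub4 uniq_s sp IF.
Qed.

End Comparison.

(** * The theorem *)

Section RelativelyFreeAlgebra.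
Variable K : fieldType.
Local Notation KX := (freealg K nat).

Lemma Tideal_gen_Tideal (S : set KX) : is_Tideal (Tideal_gen S).
Proof.
split; first split=> [M [[[]]]//|u v Ju Jv M MP|a u b Ju M MP].
- by have [[[_ D _] _] _] := MP; apply: D; [apply: Ju | apply: Jv].
- by have [[[_ _ MM] _] _] := MP; apply: MM; apply: Ju.
by move=> phi f Jf M MP; have [[_ stable] _] := MP; apply: stable; apply: Jf.
Qed.

(** Evaluating at the classes of the variables gives one inclusion; the other one is
    stability under endomorphisms, since every evaluation lifts to K<X>. *)
Lemma Id_quot_Tideal (J : properIdeal KX) :
  is_Tideal (ideal_set J) -> Id (quotalg J) = ideal_set J.
Proof.
move=> [_ stable]; apply/seteqP; split=> f; last first.
  move=> Jf a; pose u i := qrepr (a i).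
  have -> : a = qpi J \o u by apply: funext => i /=; rewrite /u qreprK.
  rewrite -lrmorph_feval; apply/qpi_eq0.
  exact: (stable (feval u)).
move=> If; apply/qpi_eq0.
exact: etrans (lrmorph_eq_feval (qpi J) f) (If _).
Qed.

End RelativelyFreeAlgebra.

Unset Implicit Arguments.
Set Strict Implicit.

Theorem theorem3p12 (K : fieldType) (charK0 : [pchar K] =i pred0)
    (n : nat) (n_ge2 : (2 <= n)%N) (n_even : ~~ odd n) :
  Id (@relfree K n 3 isT) =
    Tideal_gen [set lncomm [:: fvar K 0%N; fvar K 1%N; fvar K 2%N; fvar K 3%N];
                    standard_poly K (n + 2)] /\
  Id (@relfree K n.+1 3 isT) = Id (@relfree K n 3 isT).
Proof.
set T := Tideal_gen _.
have T_Tideal : is_Tideal T by apply: Tideal_gen_Tideal.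
have T_sub_Id : T `<=` Id (@relfree K n.+1 3 isT).
  apply: smallest_sub; first exact: Id_Tideal.
  move=> f [->|->].
    exact: (Id_comm4P _).2 (@relfree_nil3 K n.+1).
  apply: (Id_standardP _ _).2.
  apply: (standard_few_generators charK0 (@relfree_nil3 K n.+1) _ _ _
    (@relfree_generated K n.+1)).
  - by rewrite oddD addbF.
  - by rewrite addn2 !ltnS (leq_trans _ n_ge2).
  by rewrite addn2.
have widen := @Id_relfree_widen K n.
(* Algebras are nonzero here, so forming the quotient by T requires that 1 is
   outside T. *)
have T_proper : ~ T 1.
  move=> /T_sub_Id /(_ (fun=> 0)); rewrite rmorph1.
  by apply/eqP/oner_neq0.
have [T_ideal _] := T_Tideal.
pose J := Defs.ProperIdeal T_ideal T_proper.
have IdJ : Id (quotalg J) = T by apply: (@Id_quot_Tideal K J).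
have T_gen f : [set lncomm [:: fvar K 0%N; fvar K 1%N; fvar K 2%N; fvar K 3%N];
    standard_poly K (n + 2)] f -> T f by move=> Sf M [_]; apply.
have nil3J : lie_nil3 (quotalg J).
  by apply: (Id_comm4P _).1; rewrite IdJ; apply: T_gen; left.
have stdJ : sats_standard (quotalg J) (n + 2).
  by apply: (Id_standardP _ _).1; rewrite IdJ; apply: T_gen; right.
have Id_sub_T : Id (@relfree K n 3 isT) `<=` T.
  by rewrite -IdJ; apply: (Id_relfree_sub charK0 n_ge2 n_even nil3J stdJ).
split; apply/seteqP; split=> // f.
- by move=> /T_sub_Id /widen.
- by move=> /Id_sub_T /T_sub_Id.
Qed.
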